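(* If $\alpha$ is a composition of $n$, then the $\mathcal H_n(0)$-module $\mathcal H_n(0)\,x_\alpha\subseteq\mathbb F[x_1,\ldots,x_n]$ has a basis $\{\overline\pi_wx_\alpha:w\in\mathfrak S_n,\ D(w)\subseteq D(\alpha)\}$ and is isomorphic to $\mathbf M_\alpha$.
   Context: $\mathbb F$ is an arbitrary field. $\mathcal H_n(0)$ is the $\mathbb F$-algebra generated by $\pi_1,\ldots,\pi_{n-1}$ with $\pi_i^2=\pi_i$ and the braid relations of $\mathfrak S_n$; $\overline\pi_i:=\pi_i-1$; for a reduced expression $w=s_{i_1}\cdots s_{i_r}$ ($s_i=(i,i+1)$), $\overline\pi_w=\overline\pi_{i_1}\cdots\overline\pi_{i_r}$. $D(w)=\{i\in\{1,\ldots,n-1\}:w(i)>w(i+1)\}$. $\mathcal H_n(0)$ acts on $\mathbb F[x_1,\ldots,x_n]$ by the Demazure operators $\pi_if=\dfrac{x_if-x_{i+1}s_i(f)}{x_i-x_{i+1}}$, where $s_i(f)$ is $f$ with $x_i$ and $x_{i+1}$ interchanged. A composition $\alpha=(\alpha_1,\ldots,\alpha_\ell)$ of $n$ is a sequence of positive integers with sum $n$; $D(\alpha)=\{\alpha_1,\alpha_1+\alpha_2,\ldots,\alpha_1+\cdots+\alpha_{\ell-1}\}$; $x_\alpha:=\prod_{i\in D(\alpha)}x_1\cdots x_i$. $\mathbf M_\alpha$ is the following $\mathcal H_n(0)$-module. Consider the skew diagram $\alpha_1\oplus\cdots\oplus\alpha_\ell$ consisting of disconnected rows of lengths $\alpha_1,\ldots,\alpha_\ell$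 from bottom to top, each strictly northeast of the previous. A basis of $\mathbf M_\alpha$ over $\mathbb F$ is the set of fillings $\tau$ of this diagram with $1,\ldots,n$, each used once, with rows increasing left to right; and $\overline\pi_i(\tau)=-\tau$ if $i$ is in a higher row of $\tau$ than $i+1$, $\overline\pi_i(\tau)=0$ if $i,i+1$ are in the same row, and $\overline\pi_i(\tau)=s_i(\tau)$ (swap the entries $i$ and $i+1$) if $i$ is in a lower row than $i+1$. *)

(* Defs.v *)
From HB Require Import structures.
From mathcomp Require Import all_boot all_order all_algebra all_fingroup.
From mathcomp Require Import generic_quotient.
From mathcomp Require Import boolp mpoly.
From mathcomp Require Import ring zify.

Set Implicit Arguments.
Unset Strict Implicit.
Unset Printing Implicit Defensive.

Import GRing.Theory.
Local Open Scope ring_scope.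
Local Open Scope quotient_scope.

(* Indices are shifted by one throughout: i : 'I_n.-1 stands for the index
   i + 1 of the simple transposition, so s_(i+1) exchanges the letters
   i + 1 and i + 2, which are lo i and hi i in 'I_n. *)
Section SimpleTranspositions.
Variable n : nat.

Lemma lo_proof (i : 'I_n.-1) : (i < n)%N.
Proof. by case: i => i /=; lia. Qed.

Lemma hi_proof (i : 'I_n.-1) : (i.+1 < n)%N.
Proof. by case: i => i /=; lia. Qed.

Definition lo (i : 'I_n.-1) : 'I_n := Ordinal (lo_proof i).
Definition hi (i : 'I_n.-1) : 'I_n := Ordinal (hi_proof i).
Definition adj (i : 'I_n.-1) : 'S_n := tperm (lo i) (hi i).

(* s_(i1) ... s_(ir) as a composition of functions, the rightmost one acting
   first; the product of 'S_n is (u * v) x = v (u x). *)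
Definition word_perm (r : seq 'I_n.-1) : 'S_n :=
  foldr (fun i w => (w * adj i)%g) 1%g r.

Definition reduced_expression (r : seq 'I_n.-1) (w : 'S_n) : Prop :=
  word_perm r = w /\
  forall r' : seq 'I_n.-1, word_perm r' = w -> (size r <= size r')%N.

Definition descents (w : 'S_n) : {set 'I_n.-1} :=
  [set i | (w (hi i) < w (lo i))%N].

Lemma lo_neq_hi i : lo i != hi i.
Proof. by rewrite -val_eqE /= neq_ltn ltnSn. Qed.

Lemma lo_next (i j : 'I_n.-1) : i.+1 = j -> lo j = hi i.
Proof. by move=> e; apply: val_inj. Qed.

Lemma adj_far (i j : 'I_n.-1) : (i.+1 < j)%N -> (adj i * adj j = adj j * adj i)%g.
Proof.
move=> lij; have d x y : (x \in [:: lo i; hi i]) -> (y \in [:: lo j; hi j]) -> x != y.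
  by rewrite !inE => /orP[]/eqP-> /orP[]/eqP->; rewrite -val_eqE /=; apply/eqP; lia.
have e z : z \in [:: lo j; hi j] -> tperm (lo i) (hi i) z = z.
  by move=> zj; apply: tpermD; apply: d; rewrite // !inE eqxx ?orbT.
have {1}<- : (adj j ^ adj i = adj j)%g.
  by rewrite /adj tpermJ !e // !inE eqxx ?orbT.
by rewrite conjgE !mulgA mulgV mul1g.
Qed.

Lemma adj_braid (i j : 'I_n.-1) : i.+1 = j ->
  (adj i * adj j * adj i = adj j * adj i * adj j)%g.
Proof.
move=> eij; have e := lo_next eij.
have d1 := lo_neq_hi i; have d2 := lo_neq_hi j.
have d3 : lo i != hi j by rewrite -val_eqE /=; apply/eqP; lia.
rewrite e in d2.
have -> : (adj i * adj j * adj i = tperm (lo i) (hi j))%g.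
  have -> : (adj i * adj j * adj i = adj j ^ adj i)%g by rewrite conjgE tpermV mulgA.
  have f : tperm (lo i) (hi i) (hi j) = hi j by apply: tpermD.
  by rewrite /adj tpermJ e tpermR f.
have -> : (adj j * adj i * adj j = adj i ^ adj j)%g by rewrite conjgE tpermV mulgA.
have f : tperm (hi i) (hi j) (lo i) = lo i by apply: tpermD; rewrite eq_sym.
by rewrite /adj tpermJ e tpermL f.
Qed.

End SimpleTranspositions.

(* The algebra H_n(0): expressions in the generators, the scalars of F, the sum
   and the product, modulo the congruence generated by the axioms of (unital,
   associative) F-algebras and the defining relations. *)
Section Hecke.
Variables (F : fieldType) (n : nat).

Inductive hterm : Type :=
  | HGen of 'I_n.-1
  | HScal of F
  | HAdd of hterm & hterm
  | HMul of hterm & hterm.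

Inductive heq : hterm -> hterm -> Prop :=
  | heq_refl x : heq x x
  | heq_sym x y : heq x y -> heq y x
  | heq_trans x y z : heq x y -> heq y z -> heq x z
  | heq_add x x' y y' : heq x x' -> heq y y' -> heq (HAdd x y) (HAdd x' y')
  | heq_mul x x' y y' : heq x x' -> heq y y' -> heq (HMul x y) (HMul x' y')
  | heq_addA x y z : heq (HAdd x (HAdd y z)) (HAdd (HAdd x y) z)
  | heq_addC x y : heq (HAdd x y) (HAdd y x)
  | heq_add0 x : heq (HAdd (HScal 0) x) x
  | heq_addN x : heq (HAdd (HMul (HScal (-1)) x) x) (HScal 0)
  | heq_mulA x y z : heq (HMul x (HMul y z)) (HMul (HMul x y) z)
  | heq_mul1l x : heq (HMul (HScal 1) x) x
  | heq_mul1r x : heq (HMul x (HScal 1)) x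
  | heq_mulDl x y z : heq (HMul (HAdd x y) z) (HAdd (HMul x z) (HMul y z))
  | heq_mulDr x y z : heq (HMul x (HAdd y z)) (HAdd (HMul x y) (HMul x z))
  | heq_scalD a b : heq (HScal (a + b)) (HAdd (HScal a) (HScal b))
  | heq_scalM a b : heq (HScal (a * b)) (HMul (HScal a) (HScal b))
  | heq_scalC a x : heq (HMul (HScal a) x) (HMul x (HScal a))
  | heq_idem i : heq (HMul (HGen i) (HGen i)) (HGen i)
  | heq_comm (i j : 'I_n.-1) of (i.+1 < j)%N :
      heq (HMul (HGen i) (HGen j)) (HMul (HGen j) (HGen i))
  | heq_braid (i j : 'I_n.-1) of i.+1 = j :
      heq (HMul (HMul (HGen i) (HGen j)) (HGen i))
          (HMul (HMul (HGen j) (HGen i)) (HGen j)).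

HB.instance Definition _ := gen_eqMixin hterm.
HB.instance Definition _ := gen_choiceMixin hterm.

Definition heqb (x y : hterm) : bool := `[< heq x y >].

Lemma heqb_equiv : equiv_class_of heqb.
Proof.
split=> [x|x y|y x z]; first exact/asboolP/heq_refl.
  by apply/asboolP/asboolP; apply: heq_sym.
by move=> /asboolP xy /asboolP yz; apply/asboolP/(heq_trans xy yz).
Qed.

Canonical heqb_equivrel := EquivRelPack heqb_equiv.

Definition hecke0 : Type := {eq_quot heqb}.
HB.instance Definition _ := Choice.on hecke0.
HB.instance Definition _ := EqQuotient.on hecke0.

Definition hclass (t : hterm) : hecke0 := \pi_(hecke0) t.

Lemma heqP x y : reflect (hclass x = hclass y) `[< heq x y >].
Proof. exact: eqmodP. Qed.

Lemma hclassK : cancel repr hclass.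
Proof. exact: reprK. Qed.

Lemma heqE x y : heq x y -> hclass x = hclass y.
Proof. by move=> xy; apply/heqP/asboolP. Qed.

Lemma heq_repr x : heq (repr (hclass x)) x.
Proof. by apply/asboolP/heqP; rewrite hclassK. Qed.

Let h0 : hecke0 := hclass (HScal 0).
Let h1 : hecke0 := hclass (HScal 1).
Let hadd (x y : hecke0) : hecke0 := hclass (HAdd (repr x) (repr y)).
Let hmul (x y : hecke0) : hecke0 := hclass (HMul (repr x) (repr y)).
Let hopp (x : hecke0) : hecke0 := hclass (HMul (HScal (-1)) (repr x)).
Let hscale (c : F) (x : hecke0) : hecke0 := hclass (HMul (HScal c) (repr x)).

Let haddE x y : hadd (hclass x) (hclass y) = hclass (HAdd x y).
Proof. by apply: heqE; apply: heq_add; apply: heq_repr. Qed.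
Let hmulE x y : hmul (hclass x) (hclass y) = hclass (HMul x y).
Proof. by apply: heqE; apply: heq_mul; apply: heq_repr. Qed.
Let hoppE x : hopp (hclass x) = hclass (HMul (HScal (-1)) x).
Proof. by apply: heqE; apply: heq_mul; [apply: heq_refl|apply: heq_repr]. Qed.
Let hscaleE c x : hscale c (hclass x) = hclass (HMul (HScal c) x).
Proof. by apply: heqE; apply: heq_mul; [apply: heq_refl|apply: heq_repr]. Qed.

Let haddA : associative hadd.
Proof.
move=> x y z; rewrite -[x]hclassK -[y]hclassK -[z]hclassK !haddE.
exact/heqE/heq_addA.
Qed.
Let haddC : commutative hadd.
Proof. move=> x y; rewrite -[x]hclassK -[y]hclassK !haddE; exact/heqE/heq_addC. Qed.
Let hadd0 : left_id h0 hadd.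
Proof. move=> x; rewrite -[x]hclassK haddE; exact/heqE/heq_add0. Qed.
Let haddN : left_inverse h0 hopp hadd.
Proof. move=> x; rewrite -[x]hclassK hoppE haddE; exact/heqE/heq_addN. Qed.
Let hmulA : associative hmul.
Proof.
move=> x y z; rewrite -[x]hclassK -[y]hclassK -[z]hclassK !hmulE.
exact/heqE/heq_mulA.
Qed.
Let hmul1l : left_id h1 hmul.
Proof. move=> x; rewrite -[x]hclassK hmulE; exact/heqE/heq_mul1l. Qed.
Let hmul1r : right_id h1 hmul.
Proof. move=> x; rewrite -[x]hclassK hmulE; exact/heqE/heq_mul1r. Qed.
Let hmulDl : left_distributive hmul hadd.
Proof.
move=> x y z; rewrite -[x]hclassK -[y]hclassK -[z]hclassK !(hmulE, haddE).
exact/heqE/heq_mulDl.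
Qed.
Let hmulDr : right_distributive hmul hadd.
Proof.
move=> x y z; rewrite -[x]hclassK -[y]hclassK -[z]hclassK !(hmulE, haddE).
exact/heqE/heq_mulDr.
Qed.

HB.instance Definition _ := GRing.isZmodule.Build hecke0 haddA haddC hadd0 haddN.
HB.instance Definition _ :=
  GRing.Zmodule_isPzRing.Build hecke0 hmulA hmul1l hmul1r hmulDl hmulDr.

Let hscaleA a b v : hscale a (hscale b v) = hscale (a * b) v.
Proof.
rewrite -[v]hclassK !hscaleE; apply: heqE; apply: heq_trans (heq_mulA _ _ _) _.
by apply: heq_mul; [apply/heq_sym/heq_scalM | apply: heq_refl].
Qed.
Let hscale1 : left_id 1 hscale.
Proof. move=> v; rewrite -[v]hclassK hscaleE; exact/heqE/heq_mul1l. Qed.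
Let hscaleDr : right_distributive hscale +%R.
Proof.
move=> a x y; rewrite -[x]hclassK -[y]hclassK /GRing.add /= !(hscaleE, haddE).
exact/heqE/heq_mulDr.
Qed.
Let hscaleDl v : {morph hscale^~ v : a b / a + b}.
Proof.
move=> a b; rewrite -[v]hclassK /= !hscaleE [RHS]haddE; apply: heqE.
apply: heq_trans (heq_mulDl _ _ _).
by apply: heq_mul; [apply: heq_scalD | apply: heq_refl].
Qed.

HB.instance Definition _ :=
  GRing.Zmodule_isLmodule.Build F hecke0 hscaleA hscale1 hscaleDr hscaleDl.

Lemma hclassD x y : hclass (HAdd x y) = hclass x + hclass y.
Proof. exact/esym/haddE. Qed.
Lemma hclassM x y : hclass (HMul x y) = hclass x * hclass y.
Proof. exact/esym/hmulE. Qed.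
Lemma hclassScal c : hclass (HScal c) = c *: (1 : hecke0).
Proof. by rewrite [RHS]hscaleE; apply/heqE/heq_sym/heq_mul1r. Qed.

(* A module over H_n(0) amounts to a vector space with operators satisfying
   the defining relations. *)
Record hecke_rep (V : lmodType F) := HeckeRep {
  hop :> 'I_n.-1 -> V -> V;
  hop_linear : forall i, linear (hop i);
  hop_idem : forall i v, hop i (hop i v) = hop i v;
  hop_comm : forall i j : 'I_n.-1, (i.+1 < j)%N ->
    forall v, hop i (hop j v) = hop j (hop i v);
  hop_braid : forall i j : 'I_n.-1, i.+1 = j ->
    forall v, hop i (hop j (hop i v)) = hop j (hop i (hop j v)) }.

Section Action.
Variables (V : lmodType F) (r : hecke_rep V).

Fixpoint term_act (t : hterm) (v : V) : V :=
  match t with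
  | HGen i => r i v
  | HScal c => c *: v
  | HAdd x y => term_act x v + term_act y v
  | HMul x y => term_act x (term_act y v)
  end.

Lemma term_act_linear t : linear (term_act t).
Proof.
elim: t => [i|c|x IHx y IHy|x IHx y IHy] a u v /=.
- exact: hop_linear.
- by rewrite scalerDr !scalerA mulrC.
- by rewrite IHx IHy scalerDr addrACA.
- by rewrite IHy IHx.
Qed.

Lemma term_actD t u v : term_act t (u + v) = term_act t u + term_act t v.
Proof. by rewrite -[u]scale1r term_act_linear !scale1r. Qed.

Lemma term_act0 t : term_act t 0 = 0.
Proof. by apply: (addIr (term_act t 0)); rewrite -term_actD !add0r. Qed.

Lemma term_actZ t c v : term_act t (c *: v) = c *: term_act t v.
Proof. by rewrite -[c *: v]addr0 term_act_linear term_act0 addr0. Qed.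

Lemma term_act_heq x y : heq x y -> forall v, term_act x v = term_act y v.
Proof.
move=> xy; elim: {x y} xy => /=.
- by [].
- by move=> x y _ IH v; rewrite IH.
- by move=> x y z _ IH1 _ IH2 v; rewrite IH1 IH2.
- by move=> a a' b b' _ IH1 _ IH2 v; rewrite IH1 IH2.
- by move=> a a' b b' _ IH1 _ IH2 v; rewrite IH1 IH2.
- by move=> x y z v; rewrite addrA.
- by move=> x y v; rewrite addrC.
- by move=> x v; rewrite scale0r add0r.
- by move=> x v; rewrite scaleN1r addNr scale0r.
- by [].
- by move=> x v; rewrite scale1r.
- by move=> x v; rewrite scale1r.
- by [].
- by move=> x y z v; rewrite term_actD.
- by move=> a b v; rewrite scalerDl.
- by move=> a b v; rewrite scalerA.
- by move=> a x v; rewrite term_actZ.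
- by move=> i v; rewrite hop_idem.
- by move=> i j ij v; rewrite (hop_comm r ij).
- by move=> i j ij v; rewrite (hop_braid r ij).
Qed.

Definition hecke_act (h : hecke0) (v : V) : V := term_act (repr h) v.

Lemma hecke_act_pi t v : hecke_act (hclass t) v = term_act t v.
Proof. exact/term_act_heq/heq_repr. Qed.

End Action.

Lemma triv_rep_linear (i : 'I_n.-1) : linear (fun v : F^o => 0 : F^o).
Proof. by move=> a u v; rewrite scaler0 addr0. Qed.

Definition triv_rep : hecke_rep F^o :=
  HeckeRep triv_rep_linear (fun _ _ => erefl) (fun _ _ _ _ => erefl)
    (fun _ _ _ _ => erefl).

Let h1_neq0 : (1 : hecke0) != 0.
Proof.
apply/eqP=> /(congr1 (fun h => hecke_act triv_rep h 1)).
rewrite !hecke_act_pi /= scale1r scale0r.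
by apply/eqP/oner_neq0.
Qed.

HB.instance Definition _ := GRing.PzSemiRing_isNonZero.Build hecke0 h1_neq0.

Let hscaleAl (a : F) (u v : hecke0) : a *: (u * v) = (a *: u) * v.
Proof.
rewrite -[u]hclassK -[v]hclassK [_ * _]hmulE [LHS]hscaleE.
rewrite [in RHS]/GRing.scale /= hscaleE [RHS]hmulE; exact/heqE/heq_mulA.
Qed.
HB.instance Definition _ := GRing.Lmodule_isLalgebra.Build F hecke0 hscaleAl.

Let hscaleAr (a : F) (u v : hecke0) : a *: (u * v) = u * (a *: v).
Proof.
rewrite -[u]hclassK -[v]hclassK [_ * _]hmulE [LHS]hscaleE.
rewrite [in RHS]/GRing.scale /= hscaleE [RHS]hmulE; apply: heqE.
apply: heq_trans (heq_mulA _ _ _) _; apply: heq_trans (heq_sym (heq_mulA _ _ _)).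
by apply: heq_mul; [apply: heq_scalC | apply: heq_refl].
Qed.
HB.instance Definition _ := GRing.Lalgebra_isAlgebra.Build F hecke0 hscaleAr.

Definition hpi (i : 'I_n.-1) : hecke0 := hclass (HGen i).
Definition hpibar (i : 'I_n.-1) : hecke0 := hpi i - 1.
Definition hpibar_word (r : seq 'I_n.-1) : hecke0 := \prod_(i <- r) hpibar i.

(* The space V of a representation r, as a module over hecke0; the alias keeps
   this structure apart from the F-linear one of V. *)
Definition hmod (V : lmodType F) (r : hecke_rep V) : Type := V.

Section Hmod.
Variables (V : lmodType F) (r : hecke_rep V).

HB.instance Definition _ := GRing.Zmodule.copy (hmod r) V.

Let act : hecke0 -> hmod r -> hmod r := hecke_act r.

Let act_scaleA a b v : act a (act b v) = act (a * b) v.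
Proof. by rewrite -[a]hclassK -[b]hclassK -hclassM /act !hecke_act_pi. Qed.
Let act1 : left_id 1 act.
Proof. by move=> v; rewrite /act hecke_act_pi /= scale1r. Qed.
Let actDr : right_distributive act +%R.
Proof. by move=> a u v; rewrite -[a]hclassK /act !hecke_act_pi term_actD. Qed.
Let actDl v : {morph act^~ v : a b / a + b}.
Proof. by move=> a b; rewrite -[a]hclassK -[b]hclassK -hclassD /act !hecke_act_pi. Qed.

HB.instance Definition _ :=
  GRing.Zmodule_isLmodule.Build hecke0 (hmod r) act_scaleA act1 actDr actDl.

Lemma hmod_scalarE (c : F) (v : V) : c%:A *: (v : hmod r) = c *: v.
Proof. by rewrite -hclassScal [LHS]hecke_act_pi. Qed.

Lemma hmod_piE i (v : V) : hpi i *: (v : hmod r) = r i v.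
Proof. exact: hecke_act_pi. Qed.

Lemma hmod_pibarE i (v : V) : hpibar i *: (v : hmod r) = r i v - v.
Proof. by rewrite scalerBl scale1r hmod_piE. Qed.

End Hmod.

End Hecke.
Arguments hpi F {n} i.
Arguments hpibar F {n} i.
Arguments hpibar_word F {n} r.

(* The braid and commutation relations of the Demazure operators, for operators
   p1, p2 attached to ring endomorphisms s, t of an integral domain. *)
Section DemazureRelations.
Variables (R : idomainType) (s t p1 p2 : R -> R).
Hypotheses (sM : {morph s : x y / x * y}) (sB : {morph s : x y / x - y}).
Hypotheses (tM : {morph t : x y / x * y}) (tB : {morph t : x y / x - y}).

Lemma demazure_rel_comm a b c d :
  s a = b -> s b = a -> s c = c -> s d = d ->
  t a = a -> t b = b -> t c = d -> t d = c ->
  a - b != 0 -> c - d != 0 ->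
  (forall x, p1 x * (a - b) = a * x - b * s x) ->
  (forall x, p2 x * (c - d) = c * x - d * t x) ->
  (forall x, s (t x) = t (s x)) -> forall f, p1 (p2 f) = p2 (p1 f).
Proof.
move=> sa sb sc sd ta tb tc td nz1 nz2 D1 D2 st f.
apply: (mulIf (mulf_neq0 nz1 nz2)).
have E1 : s (p2 f) * (c - d) = c * s f - d * s (t f).
  by have := congr1 s (D2 f); rewrite !(sB, sM) sc sd.
have E2 : t (p1 f) * (a - b) = a * t f - b * s (t f).
  by have := congr1 t (D1 f); rewrite !(tB, tM) ta tb st.
transitivity (a * (c * f - d * t f) - b * (c * s f - d * s (t f))).
  by rewrite mulrA D1 -D2 -E1; ring.
transitivity (c * (a * f - b * s f) - d * (a * t f - b * s (t f))); first by ring.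
rewrite [_ * (c - d)]mulrC mulrA D2 -D1 -E2; ring.
Qed.

Lemma demazure_rel_braid a b c :
  s a = b -> s b = a -> s c = c -> t a = a -> t b = c -> t c = b ->
  a - b != 0 -> b - c != 0 -> a - c != 0 ->
  (forall x, p1 x * (a - b) = a * x - b * s x) ->
  (forall x, p2 x * (b - c) = b * x - c * t x) ->
  (forall x, s (p1 x) = p1 x) -> (forall x, t (p2 x) = p2 x) ->
  (forall x, s (t (s x)) = t (s (t x))) ->
  forall f, p1 (p2 (p1 f)) = p2 (p1 (p2 f)).
Proof.
move=> sab sba scc taa tbc tcb nz1 nz2 nz3 D1 D2 S1 T2 sts f.
have tD1 x : t (p1 x) * (a - c) = a * t x - c * t (s x).
  by have := congr1 t (D1 x); rewrite !(tB, tM) taa tbc.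
have sD2 x : s (p2 x) * (a - c) = a * s x - c * s (t x).
  by have := congr1 s (D2 x); rewrite !(sB, sM) sba scc.
have stD1 x : s (t (p1 x)) * (b - c) = b * s (t x) - c * s (t (s x)).
  by have := congr1 s (tD1 x); rewrite !(sB, sM) sab scc.
have tsD2 x : t (s (p2 x)) * (a - b) = a * t (s x) - b * t (s (t x)).
  by have := congr1 t (sD2 x); rewrite !(tB, tM) taa tcb.
pose D := (a - b) * (b - c) * (a - c).
have D0 : D != 0 by rewrite !mulf_neq0.
apply: (mulIf (mulf_neq0 D0 D0)).
have stst : t (s (t f)) = s (t (s f)) by rewrite sts.
transitivity (a * b * (a - c) * (a * f - b * s f) * (b - c) * (a - c)
  - a * c * (a - c) * (a * t f - c * t (s f)) * (a - b) * (b - c)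
  - b * a * (b - c) * (a * f - b * s f) * (b - c) * (a - c)
  + b * c * (b - c) * (b * s (t f) - c * s (t (s f))) * (a - b) * (a - c)).
  transitivity (p1 (p2 (p1 f)) * (a - b)
    * ((b - c) * (a - c) * D)); first by rewrite /D; ring.
  rewrite D1; transitivity (
      a * (p2 (p1 f) * (b - c)) * ((a - c) * D)
      - b * (s (p2 (p1 f)) * (a - c)) * ((b - c) * D)).
    by ring.
  rewrite D2 sD2 S1 -D1 -tD1 -stD1 /D; ring.
transitivity (b * a * (a - c) * (b * f - c * t f) * (a - b) * (a - c)
  - b * b * (a - c) * (a * s f - c * s (t f)) * (a - b) * (b - c)
  - c * a * (a - b) * (b * f - c * t f) * (a - b) * (a - c)
  + c * c * (a - b) * (a * t (s f) - b * t (s (t f))) * (b - c) * (a - c)).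
  rewrite stst; ring.
apply/esym; transitivity (p2 (p1 (p2 f)) * (b - c)
    * ((a - b) * (a - c) * D)); first by rewrite /D; ring.
rewrite D2; transitivity (
    b * (p1 (p2 f) * (a - b)) * ((a - c) * D)
    - c * (t (p1 (p2 f)) * (a - c)) * ((a - b) * D)).
  by ring.
rewrite D1 tD1 T2 -D2 -sD2 -tsD2 /D; ring.
Qed.

End DemazureRelations.

Section Demazure.
Variables (F : fieldType) (n : nat).
Implicit Types (f g : {mpoly F[n]}) (i j : 'I_n.-1).

Lemma msym_var (s : 'S_n) k : msym s 'X_k = 'X_(s k) :> {mpoly F[n]}.
Proof. by rewrite /msym mmapX mmap1U. Qed.

Lemma mpoly_gen_ind (P : {mpoly F[n]} -> Prop) :
  P 0 -> P 1 -> (forall g h, P g -> P h -> P (g + h)) ->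
  (forall g h, P g -> P h -> P (g * h)) -> (forall k, P 'X_k) ->
  (forall c g, P g -> P (c *: g)) -> forall f, P f.
Proof.
move=> P0 P1 PD PM PX PZ f; rewrite [f]mpolyE.
apply: (big_ind P) => // m _; apply: PZ; rewrite mpolyXE_id.
apply: (big_ind P) => // k _.
by elim: (m k) => [|d IH]; [rewrite expr0 | rewrite exprS; apply: PM].
Qed.

Lemma msym_adj_dvd i f :
  exists q, q * ('X_(lo i) - 'X_(hi i)) = f - msym (adj i) f.
Proof.
pose P f := exists q, q * ('X_(lo i) - 'X_(hi i)) = f - msym (adj i) f.
have PD g h : P g -> P h -> P (g + h).
  move=> [p ep] [q eq]; exists (p + q).
  by rewrite mulrDl ep eq msymD opprD addrACA.
have PM g h : P g -> P h -> P (g * h).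
  move=> [p ep] [q eq]; exists (p * h + msym (adj i) g * q).
  rewrite msymM; transitivity ((p * ('X_(lo i) - 'X_(hi i))) * h +
    msym (adj i) g * (q * ('X_(lo i) - 'X_(hi i)))); first by ring.
  by rewrite ep eq; ring.
have P0 : P 0 by exists 0; rewrite mul0r raddf0 subrr.
have P1 : P 1 by exists 0; rewrite mul0r msym1 subrr.
have PX k : P 'X_k.
  rewrite /P msym_var /adj; case: tpermP => [->|->|_ _].
  - by exists 1; rewrite mul1r.
  - by exists (-1); rewrite mulN1r opprB.
  - by exists 0; rewrite mul0r subrr.
have PZ c g : P g -> P (c *: g).
  by case=> q eq; exists (c *: q); rewrite msymZ -scalerAl eq scalerBr.
exact: (mpoly_gen_ind P0 P1 PD PM PX PZ).
Qed.

Lemma demazure_exists i f :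
  exists g, g * ('X_(lo i) - 'X_(hi i)) =
            'X_(lo i) * f - 'X_(hi i) * msym (adj i) f.
Proof.
have [q eq] := msym_adj_dvd i f; exists (f + 'X_(hi i) * q).
by rewrite mulrDl -mulrA eq; ring.
Qed.

(* The quotient (x_i f - x_(i+1) s_i(f)) / (x_i - x_(i+1)); it exists by the
   previous lemma, and is unique since {mpoly F[n]} is an integral domain. *)
Definition demazure i f : {mpoly F[n]} := sval (cid (demazure_exists i f)).

Lemma demazureE i f : demazure i f * ('X_(lo i) - 'X_(hi i)) =
  'X_(lo i) * f - 'X_(hi i) * msym (adj i) f.
Proof. exact: svalP (cid (demazure_exists i f)). Qed.

Lemma mvarB_neq0 (k l : 'I_n) : k != l -> 'X_k - 'X_l != 0 :> {mpoly F[n]}.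
Proof.
move=> kl; rewrite subr_eq0; apply/eqP=> /(congr1 (mcoeff U_(k))) /eqP.
rewrite !mcoeffX.
have -> : (U_(l)%MM == U_(k)%MM) = (k == l).
  by apply/eqP/eqP=> [/(congr1 (fun m : 'X_{1..n} => m k))|->//];
     rewrite !mnm1E eqxx; case: eqVneq.
by rewrite eqxx (negPf kl) oner_eq0.
Qed.

Lemma demazure_uniq i f g : g * ('X_(lo i) - 'X_(hi i)) =
  'X_(lo i) * f - 'X_(hi i) * msym (adj i) f -> g = demazure i f.
Proof.
by rewrite -demazureE; apply/mulIf/mvarB_neq0/lo_neq_hi.
Qed.

Lemma msym_adjK i f : msym (adj i) (msym (adj i) f) = f.
Proof. by rewrite -msymMm tperm2 msym1m. Qed.

Lemma demazure_linear i : linear (demazure i).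
Proof.
move=> a f g; apply/esym/demazure_uniq.
rewrite mulrDl -scalerAl !demazureE msymD msymZ !mulrDr -!scalerAr scalerBr.
by rewrite opprD addrACA.
Qed.

Lemma msym_demazure i f : msym (adj i) (demazure i f) = demazure i f.
Proof.
apply: demazure_uniq; have := congr1 (msym (adj i)) (demazureE i f).
rewrite msymM !msymB !msymM msym_adjK !msym_var tpermL tpermR => e.
apply: oppr_inj; rewrite -mulrN !opprB; exact: e.
Qed.

Lemma demazure_fixed i f : msym (adj i) f = f -> demazure i f = f.
Proof. by move=> e; apply/esym/demazure_uniq; rewrite e; ring. Qed.

Lemma demazure_idem i f : demazure i (demazure i f) = demazure i f.
Proof. exact/demazure_fixed/msym_demazure. Qed.

Lemma demazure_comm i j : (i.+1 < j)%N ->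
  forall f, demazure i (demazure j f) = demazure j (demazure i f).
Proof.
move=> ij f.
have d x y : (x \in [:: lo i; hi i]) -> (y \in [:: lo j; hi j]) -> x != y.
  by rewrite !inE => /orP[]/eqP-> /orP[]/eqP->; rewrite -val_eqE /=; apply/eqP; lia.
have h1 : lo i \in [:: lo i; hi i] by rewrite inE eqxx.
have h2 : hi i \in [:: lo i; hi i] by rewrite !inE eqxx orbT.
have h3 : lo j \in [:: lo j; hi j] by rewrite inE eqxx.
have h4 : hi j \in [:: lo j; hi j] by rewrite !inE eqxx orbT.
apply: (@demazure_rel_comm _ (msym (adj i)) (msym (adj j)) _ _ _ _ _ _
  'X_(lo i) 'X_(hi i) 'X_(lo j) 'X_(hi j)).
- exact: msymM.
- exact: msymB.
- exact: msymM.
- exact: msymB.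
- by rewrite msym_var tpermL.
- by rewrite msym_var tpermR.
- by rewrite msym_var tpermD // d.
- by rewrite msym_var tpermD // d.
- by rewrite msym_var tpermD // eq_sym d.
- by rewrite msym_var tpermD // eq_sym d.
- by rewrite msym_var tpermL.
- by rewrite msym_var tpermR.
- exact/mvarB_neq0/lo_neq_hi.
- exact/mvarB_neq0/lo_neq_hi.
- exact: demazureE.
- exact: demazureE.
- by move=> x; rewrite -[LHS]msymMm -[RHS]msymMm (adj_far ij).
Qed.

Lemma demazure_braid i j : i.+1 = j -> forall f,
  demazure i (demazure j (demazure i f)) = demazure j (demazure i (demazure j f)).
Proof.
move=> ij f; have br := adj_braid ij.
have e := lo_next ij; have d1 := lo_neq_hi i; have d2 := lo_neq_hi j.
have d3 : lo i != hi j by rewrite -val_eqE /=; apply/eqP; lia.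
have vz1 := mvarB_neq0 d1; have vz2 := mvarB_neq0 d2; have vz3 := mvarB_neq0 d3.
have Ej := demazureE j; rewrite e in vz2 Ej.
apply: (@demazure_rel_braid _ (msym (adj i)) (msym (adj j)) _ _ _ _ _ _
  'X_(lo i) 'X_(hi i) 'X_(hi j)).
- exact: msymM.
- exact: msymB.
- exact: msymM.
- exact: msymB.
- by rewrite msym_var tpermL.
- by rewrite msym_var tpermR.
- by rewrite msym_var tpermD // -e.
- by rewrite msym_var tpermD // eq_sym // e.
- by rewrite msym_var -e tpermL.
- by rewrite msym_var -e tpermR.
- exact: vz1.
- exact: vz2.
- exact: vz3.
- exact: demazureE.
- exact: Ej.
- exact: msym_demazure.
- exact: msym_demazure.
- move=> x; rewrite -[in LHS]msymMm -[LHS]msymMm -[in RHS]msymMm -[RHS]msymMm.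
  by rewrite !mulgA br.
Qed.

Definition demazure_rep : hecke_rep n {mpoly F[n]} :=
  HeckeRep demazure_linear demazure_idem demazure_comm demazure_braid.

End Demazure.

Definition is_composition (n : nat) (alpha : seq nat) : bool :=
  (0%N \notin alpha) && (sumn alpha == n).

Definition comp_descents (n : nat) (alpha : seq nat) : {set 'I_n.-1} :=
  [set i : 'I_n.-1 |
    i.+1 \in [seq sumn (take k alpha) | k <- iota 1 (size alpha).-1]].

(* In the shifted indexing the factor x_1 ... x_(i+1) is the product of the 'X_k
   with k <= i. *)
Definition x_comp (F : fieldType) (n : nat) (alpha : seq nat) : {mpoly F[n]} :=
  \prod_(i in comp_descents n alpha) \prod_(k < n | (k <= i)%N) 'X_k.

Section Fillings.
Variables (n : nat) (alpha : seq nat).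

(* The cells (row, column) of the skew diagram; rows are numbered from bottom to
   top and entries take their values in 'I_n. *)
Definition cell : finType := {r : 'I_(size alpha) & 'I_(nth 0 alpha r)%N}.

Definition mk_cell (r : 'I_(size alpha)) (a : 'I_(nth 0 alpha r)%N) : cell :=
  Tagged (fun r : 'I_(size alpha) => 'I_(nth 0 alpha r)%N) a.

Definition is_filling (tau : {ffun cell -> 'I_n}) : bool :=
  [forall k, #|[set c | tau c == k]| == 1%N] &&
  [forall r : 'I_(size alpha), forall a : 'I_(nth 0 alpha r)%N,
    forall b : 'I_(nth 0 alpha r)%N, (a < b)%N ==>
      (tau (mk_cell a) < tau (mk_cell b))%N].

Record filling := Filling {
  filling_fun :> {ffun cell -> 'I_n};
  fillingP : is_filling filling_fun }.

HB.instance Definition _ := [isSub for filling_fun].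
HB.instance Definition _ := [Finite of filling by <:].

Lemma filling_ex (tau : filling) (k : 'I_n) : exists c, tau c == k.
Proof.
case/andP: (fillingP tau) => /forallP/(_ k)/cards1P[c e] _; exists c.
by move/setP/(_ c): e; rewrite !inE eqxx.
Qed.

Definition row_of (tau : filling) (k : 'I_n) : nat :=
  val (tag (xchoose (filling_ex tau k))).

Lemma filling_inj (tau : filling) : injective tau.
Proof.
case/andP: (fillingP tau) => /forallP U _ c d e.
case/cards1P: (U (tau c)) => x /setP S; have := S c; have := S d.
by rewrite !inE e eqxx => /esym/eqP-> /esym/eqP->.
Qed.

Lemma row_ofE (tau : filling) (c : cell) : row_of tau (tau c) = val (tag c).
Proof.
rewrite /row_of; congr (val (tag _)); apply: (@filling_inj tau).
exact/eqP/(xchooseP (filling_ex tau (tau c))).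
Qed.

(* s_i(tau). When i and i + 1 lie in the same row this is not a filling, and the
   value returned is tau; that case is not used below. *)
Definition swap_fun (i : 'I_n.-1) (tau : filling) : {ffun cell -> 'I_n} :=
  [ffun c => adj i (tau c)].

Definition swap (i : 'I_n.-1) (tau : filling) : filling :=
  insubd tau (swap_fun i tau).

Lemma swapP i tau : row_of tau (lo i) != row_of tau (hi i) ->
  is_filling (swap_fun i tau).
Proof.
move=> ne; case/andP: (fillingP tau) => /forallP U /forallP I; apply/andP; split.
  apply/forallP=> k; rewrite -(eqP (U (adj i k))); apply/eqP.
  apply: eq_card=> c; rewrite !inE ffunE.
  by apply/eqP/eqP=> [<-|->]; rewrite tpermK.
apply/forallP=> r; apply/forallP=> a; apply/forallP=> b; apply/implyP=> ab.
have := I r => /forallP/(_ a)/forallP/(_ b); rewrite ab /= !ffunE.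
have : row_of tau (tau (mk_cell a)) = row_of tau (tau (mk_cell b)).
  by rewrite !row_ofE.
move: (tau (mk_cell a)) (tau (mk_cell b)) => x y exy xy.
have nxy : ~~ ((x == lo i) && (y == hi i)).
  by apply: contra ne => /andP[/eqP <- /eqP <-]; rewrite exy.
move: nxy xy; rewrite /adj.
case: tpermP => [->|->|/eqP x1 /eqP x2]; case: tpermP => [->|->|/eqP y1 /eqP y2];
  rewrite ?eqxx //=; move: x1 x2 y1 y2 || move: x1 x2 || move: y1 y2 || idtac;
  do 6?[rewrite -val_eqE /=]; lia.
Qed.

Lemma swapE i tau : row_of tau (lo i) != row_of tau (hi i) ->
  swap i tau = swap_fun i tau :> {ffun cell -> 'I_n}.
Proof. by move=> ne; rewrite /swap /insubd insubT ?swapP. Qed.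

Lemma row_of_swap i tau k : row_of tau (lo i) != row_of tau (hi i) ->
  row_of (swap i tau) k = row_of tau (adj i k).
Proof.
move=> ne; have [c /eqP <-] := filling_ex (swap i tau) k.
by rewrite row_ofE (swapE ne) ffunE tpermK row_ofE.
Qed.

(* The space with basis the fillings; the filling tau is the function fbase tau. *)
Variable F : fieldType.
Definition fillings_space : lmodType F := {ffun filling -> F^o}.

Definition fbase (tau : filling) : fillings_space :=
  [ffun sigma => (sigma == tau)%:R].

Definition Mpibar_fbase (i : 'I_n.-1) (tau : filling) : fillings_space :=
  if (row_of tau (hi i) < row_of tau (lo i))%N then - fbase tau
  else if row_of tau (lo i) == row_of tau (hi i) then 0
  else fbase (swap i tau).

Definition Mpibar (i : 'I_n.-1) (v : fillings_space) : fillings_space :=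
  \sum_tau v tau *: Mpibar_fbase i tau.

Definition Mpi (i : 'I_n.-1) (v : fillings_space) : fillings_space :=
  Mpibar i v + v.

Lemma fbase_decomp (v : fillings_space) : v = \sum_tau v tau *: fbase tau.
Proof.
apply/ffunP=> s; rewrite sum_ffunE (bigD1 s) //= big1 ?addr0 => [|t ts].
  by rewrite !ffunE eqxx /GRing.scale /= mulr1.
by rewrite !ffunE eq_sym (negPf ts) scaler0.
Qed.

Lemma Mpibar_linear i : linear (Mpibar i).
Proof.
move=> a u v; rewrite /Mpibar scaler_sumr -big_split /=; apply: eq_bigr => t _.
by rewrite !ffunE scalerDl scalerA.
Qed.

HB.instance Definition _ i := GRing.isLinear.Build F fillings_space fillings_space
  _ (Mpibar i) (Mpibar_linear i).

Lemma MpibarE i tau : Mpibar i (fbase tau) = Mpibar_fbase i tau.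
Proof.
rewrite /Mpibar (bigD1 tau) //= big1 ?addr0 => [|t ts].
  by rewrite ffunE eqxx scale1r.
by rewrite ffunE (negPf ts) scale0r.
Qed.

Lemma linear_fbase (f g : {linear fillings_space -> fillings_space}) :
  (forall tau, f (fbase tau) = g (fbase tau)) -> f =1 g.
Proof.
move=> e v; rewrite [v]fbase_decomp !linear_sum; apply: eq_bigr => t _.
by rewrite !linearZ /= e.
Qed.

Lemma Mpibar_gt i tau : (row_of tau (hi i) < row_of tau (lo i))%N ->
  Mpibar i (fbase tau) = - fbase tau.
Proof. by move=> h; rewrite MpibarE /Mpibar_fbase h. Qed.

Lemma Mpibar_eq i tau : row_of tau (lo i) = row_of tau (hi i) ->
  Mpibar i (fbase tau) = 0.
Proof. by move=> h; rewrite MpibarE /Mpibar_fbase h ltnn eqxx. Qed.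

Lemma Mpibar_lt i tau : (row_of tau (lo i) < row_of tau (hi i))%N ->
  Mpibar i (fbase tau) = fbase (swap i tau).
Proof.
by move=> h; rewrite MpibarE /Mpibar_fbase ltnNge ltnW //= ltn_eqF.
Qed.

Lemma Mpibar_sqr i v : Mpibar i (Mpibar i v) = - Mpibar i v.
Proof.
apply: (linear_fbase (f := Mpibar i \o Mpibar i) (g := \- Mpibar i)) => t /=.
have [h|h|h] := ltngtP (row_of t (lo i)) (row_of t (hi i)).
- rewrite (Mpibar_lt h) Mpibar_gt // !row_of_swap ?ltn_eqF //.
  by rewrite tpermL tpermR.
- by rewrite (Mpibar_gt h) linearN /= (Mpibar_gt h).
- by rewrite (Mpibar_eq h) linear0 oppr0.
Qed.

Ltac mrow ev :=
  ev;
  first [ lia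
        | match goal with |- context [row_of (swap ?m ?t) ?k] =>
            rewrite (@row_of_swap m t k); mrow ev end ].

Ltac mstep ev :=
  match goal with
  | |- context [Mpibar ?m 0] => rewrite [Mpibar m 0]linear0
  | |- context [Mpibar ?m (- ?v)] => rewrite [Mpibar m (- v)]linearN /=
  | |- context [Mpibar ?m (fbase ?t)] =>
      first [ rewrite (@Mpibar_lt m t); last by mrow ev
            | rewrite (@Mpibar_gt m t); last by mrow ev
            | rewrite (@Mpibar_eq m t); last by mrow ev ]
  end.

Lemma Mpibar_comm (i j : 'I_n.-1) : (i.+1 < j)%N ->
  forall v, Mpibar i (Mpibar j v) = Mpibar j (Mpibar i v).
Proof.
move=> ij v.
apply: (linear_fbase (f := Mpibar i \o Mpibar j) (g := Mpibar j \o Mpibar i)).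
move=> t /= {v}.
have d x y : (x \in [:: lo i; hi i]) -> (y \in [:: lo j; hi j]) -> x != y.
  by rewrite !inE => /orP[]/eqP-> /orP[]/eqP->; rewrite -val_eqE /=; apply/eqP; lia.
have h1 : lo i \in [:: lo i; hi i] by rewrite inE eqxx.
have h2 : hi i \in [:: lo i; hi i] by rewrite !inE eqxx orbT.
have h3 : lo j \in [:: lo j; hi j] by rewrite inE eqxx.
have h4 : hi j \in [:: lo j; hi j] by rewrite !inE eqxx orbT.
have e1 : adj i (lo j) = lo j by rewrite tpermD // d.
have e2 : adj i (hi j) = hi j by rewrite tpermD // d.
have e3 : adj j (lo i) = lo i by rewrite tpermD // eq_sym d.
have e4 : adj j (hi i) = hi i by rewrite tpermD // eq_sym d.
have sw : (row_of t (lo i) < row_of t (hi i))%N ->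
  (row_of t (lo j) < row_of t (hi j))%N -> swap i (swap j t) = swap j (swap i t).
  move=> h k; apply/val_inj/ffunP=> c /=.
  rewrite (@swapE i); last by mrow ltac:(rewrite ?(e1, e2, e3, e4)).
  rewrite [LHS]ffunE (@swapE j); last by mrow ltac:(rewrite ?(e1, e2, e3, e4)).
  rewrite (@swapE j); last by mrow ltac:(rewrite ?(e1, e2, e3, e4)).
  rewrite ffunE [RHS]ffunE (@swapE i); last by mrow ltac:(rewrite ?(e1, e2, e3, e4)).
  by rewrite ffunE -!permM (adj_far ij).
have [h|h|h] := ltngtP (row_of t (lo i)) (row_of t (hi i));
  have [k|k|k] := ltngtP (row_of t (lo j)) (row_of t (hi j)).
all: do ?mstep ltac:(rewrite ?(e1, e2, e3, e4)).
all: by rewrite ?(opprK, oppr0) ?sw.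
Qed.

Lemma swap_braid (i j : 'I_n.-1) (t : filling) : i.+1 = j ->
  (row_of t (lo i) < row_of t (hi i))%N -> (row_of t (lo j) < row_of t (hi j))%N ->
  swap i (swap j (swap i t)) = swap j (swap i (swap j t)).
Proof.
move=> ij h k.
have e := lo_next ij; have d1 := lo_neq_hi i; have d2 := lo_neq_hi j.
have d3 : lo i != hi j by rewrite -val_eqE /=; apply/eqP; lia.
have t1 : adj i (lo i) = hi i by rewrite tpermL.
have t2 : adj i (hi i) = lo i by rewrite tpermR.
have t3 : adj i (hi j) = hi j by rewrite tpermD // -e.
have t4 : adj j (lo i) = lo i by rewrite tpermD // eq_sym // e.
have t5 : adj j (hi i) = hi j by rewrite -e tpermL.
have t6 : adj j (hi j) = hi i by rewrite tpermR e.
rewrite e in k.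
apply/val_inj/ffunP=> c /=.
rewrite (@swapE i); last by mrow ltac:(rewrite ?(e, t1, t2, t3, t4, t5, t6)).
rewrite [LHS]ffunE (@swapE j); last by mrow ltac:(rewrite ?(e, t1, t2, t3, t4, t5, t6)).
rewrite [X in adj _ X = _]ffunE (@swapE i); last by mrow ltac:(rewrite ?(e, t1, t2, t3, t4, t5, t6)).
rewrite [X in adj _ (adj _ X) = _]ffunE (@swapE j); last by mrow ltac:(rewrite ?(e, t1, t2, t3, t4, t5, t6)).
rewrite [RHS]ffunE (@swapE i); last by mrow ltac:(rewrite ?(e, t1, t2, t3, t4, t5, t6)).
rewrite [X in _ = adj _ X]ffunE (@swapE j); last by mrow ltac:(rewrite ?(e, t1, t2, t3, t4, t5, t6)).
rewrite ffunE -!permM.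
by congr (fun_of_perm _ _); rewrite !mulgA (adj_braid ij).
Qed.

Lemma Mpibar_braid (i j : 'I_n.-1) : i.+1 = j ->
  forall v, Mpibar i (Mpibar j (Mpibar i v)) = Mpibar j (Mpibar i (Mpibar j v)).
Proof.
move=> ij v.
apply: (linear_fbase (f := Mpibar i \o (Mpibar j \o Mpibar i))
  (g := Mpibar j \o (Mpibar i \o Mpibar j))).
move=> t /= {v}; have sb := @swap_braid i j t ij.
have e := lo_next ij; have d1 := lo_neq_hi i; have d2 := lo_neq_hi j.
have d3 : lo i != hi j by rewrite -val_eqE /=; apply/eqP; lia.
have t1 : adj i (lo i) = hi i by rewrite tpermL.
have t2 : adj i (hi i) = lo i by rewrite tpermR.
have t3 : adj i (hi j) = hi j by rewrite tpermD // -e.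
have t4 : adj j (lo i) = lo i by rewrite tpermD // eq_sym // e.
have t5 : adj j (hi i) = hi j by rewrite -e tpermL.
have t6 : adj j (hi j) = hi i by rewrite tpermR e.
rewrite e in sb.
have [h|h|h] := ltngtP (row_of t (lo i)) (row_of t (hi i));
have [k|k|k] := ltngtP (row_of t (hi i)) (row_of t (hi j));
have [l|l|l] := ltngtP (row_of t (lo i)) (row_of t (hi j)); try lia.
all: do ?mstep ltac:(rewrite ?(e, t1, t2, t3, t4, t5, t6)).
all: by rewrite ?(opprK, oppr0) ?sb.
Qed.

Lemma Mpi_linear i : linear (Mpi i).
Proof.
by move=> a u v; rewrite /Mpi linearP scalerDr addrACA.
Qed.

Lemma MpibarD i u v : Mpibar i (u + v) = Mpibar i u + Mpibar i v.
Proof. exact: linearD. Qed.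

Lemma Mpi_idem i v : Mpi i (Mpi i v) = Mpi i v.
Proof. by rewrite /Mpi MpibarD Mpibar_sqr addNr add0r. Qed.

Lemma add1_comm (V : zmodType) (A B : V -> V) :
  {morph A : x y / x + y} -> {morph B : x y / x + y} ->
  (forall v, A (B v) = B (A v)) ->
  forall v, A (B v + v) + (B v + v) = B (A v + v) + (A v + v).
Proof. by move=> AD BD AB v; rewrite AD BD AB addrACA. Qed.

Lemma add1_braid (V : zmodType) (A B : V -> V) :
  {morph A : x y / x + y} -> {morph B : x y / x + y} ->
  (forall v, A (A v) = - A v) -> (forall v, B (B v) = - B v) ->
  (forall v, A (B (A v)) = B (A (B v))) ->
  let A1 v := A v + v in let B1 v := B v + v in
  forall v, A1 (B1 (A1 v)) = B1 (A1 (B1 v)).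
Proof.
move=> AD BD AA BB AB A1 B1 v; rewrite /A1 /B1 !(AD, BD) AA BB AB.
rewrite !addNr !addr0 -!addrA; congr (_ + _).
by rewrite addrCA; congr (_ + (_ + _)); rewrite addrCA.
Qed.

Lemma Mpi_comm (i j : 'I_n.-1) : (i.+1 < j)%N ->
  forall v, Mpi i (Mpi j v) = Mpi j (Mpi i v).
Proof.
move=> ij; exact: (add1_comm (MpibarD i) (MpibarD j) (Mpibar_comm ij)).
Qed.

Lemma Mpi_braid (i j : 'I_n.-1) : i.+1 = j ->
  forall v, Mpi i (Mpi j (Mpi i v)) = Mpi j (Mpi i (Mpi j v)).
Proof.
move=> ij; exact: (add1_braid (MpibarD i) (MpibarD j) (Mpibar_sqr i)
  (Mpibar_sqr j) (Mpibar_braid ij)).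
Qed.

Definition M_rep : hecke_rep n fillings_space :=
  HeckeRep Mpi_linear Mpi_idem Mpi_comm Mpi_braid.

End Fillings.

Definition poly_module (F : fieldType) (n : nat) : lmodType (hecke0 F n) :=
  hmod (demazure_rep F n).

Definition M_module (F : fieldType) (n : nat) (alpha : seq nat) :
    lmodType (hecke0 F n) :=
  hmod (M_rep n alpha F).

Lemma M_module_pibarE (F : fieldType) (n : nat) (alpha : seq nat) i
    (tau : filling n alpha) :
  hpibar F i *: (fbase F tau : M_module F n alpha) = Mpibar_fbase F i tau.
Proof. by rewrite [LHS]hmod_pibarE /= /Mpi addrK MpibarE. Qed.

Section CyclicSubmodule.
Variables (A : pzRingType) (V : lmodType A) (v : V).

Definition in_cyclic : {pred V} := [pred u | `[< exists a : A, u = a *: v >]].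

Lemma in_cyclic_submod : submod_closed in_cyclic.
Proof.
split=> [|a x y]; first by apply/asboolP; exists 0; rewrite scale0r.
move=> /asboolP[b ->] /asboolP[c ->]; apply/asboolP; exists (a * b + c).
by rewrite scalerDl scalerA.
Qed.

Record cyclic_submod := CyclicSubmod {
  cyclic_val :> V;
  cyclic_valP : cyclic_val \in in_cyclic }.

HB.instance Definition _ := [isSub for cyclic_val].
HB.instance Definition _ := [Choice of cyclic_submod by <:].
HB.instance Definition _ :=
  GRing.SubChoice_isSubLmodule.Build A V in_cyclic cyclic_submod in_cyclic_submod.

Lemma mem_cyclic (a : A) : a *: v \in in_cyclic.
Proof. by apply/asboolP; exists a. Qed.

Definition cyclic_elt (a : A) : cyclic_submod := CyclicSubmod (mem_cyclic a).

Lemma cyclic_val_linear : linear cyclic_val.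
Proof. by []. Qed.

End CyclicSubmodule.

(* A module U over an F-algebra A is an F-vector space through c |-> c%:A. *)
Definition is_basis (F : fieldType) (A : lalgType F) (U : lmodType A)
    (I : finType) (b : I -> U) : Prop :=
  (forall c : I -> F, \sum_i (c i)%:A *: b i = 0 -> forall i, c i = 0) /\
  (forall u : U, exists c : I -> F, u = \sum_i (c i)%:A *: b i).

Definition isomorphic_modules (A : pzRingType) (U V : lmodType A) : Prop :=
  exists f : {linear U -> V}, bijective f.

Lemma word_perm_surj n (w : 'S_n) : exists r, word_perm r = w.
Proof.
pose P (w : 'S_n) := exists r, word_perm r = w.
have PM u v : P u -> P v -> P (u * v)%g.
  move=> [r <-] [r' <-]; exists (r' ++ r); elim: r' => /= [|i r' IH].
    by rewrite mulg1.
  by rewrite IH mulgA.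
have PA i : P (adj i) by exists [:: i]; rewrite /= mul1g.
have PT d (x y : 'I_n) : (y = x + d.+1 :> nat)%N -> P (tperm x y).
  elim: d y => [|d IH] y exy; have ly := ltn_ord y.
    have li : (x < n.-1)%N by lia.
    suff -> : tperm x y = adj (Ordinal li) by [].
    by congr (tperm _ _); apply: val_inj => //=; lia.
  have li : (x + d.+1 < n.-1)%N by lia.
  pose i := Ordinal li.
  have -> : tperm x y = (tperm x (lo i) ^ adj i)%g.
    rewrite tpermJ [in X in _ = tperm _ X]tpermL [in X in _ = tperm X _]tpermD;
      last 2 first.
    - by rewrite -val_eqE /=; apply/eqP; lia.
    - by rewrite -val_eqE /=; apply/eqP; lia.
    by congr tperm; apply: val_inj => /=; lia.
  by rewrite conjgE tpermV; apply: (PM _ _ (PA i)); apply: (PM _ _ _ (PA i)); apply: IH.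
have [ts -> _] := prod_tpermP w; apply: (big_ind P) => //; first by exists [::].
move=> [x y] _ /=; case: (ltngtP x y) => [xy|yx|/val_inj ->].
- by apply: (PT (y - x).-1); lia.
- by rewrite tpermC; apply: (PT (x - y).-1); lia.
- by rewrite tperm1; exists [::].
Qed.

Lemma reduced_expression_ex n (w : 'S_n) : exists r, reduced_expression r w.
Proof.
have [r0 e0] := word_perm_surj w.
pose P k := `[< exists2 r : seq 'I_n.-1, word_perm r = w & size r = k >].
have exP : exists k, P k by exists (size r0); apply/asboolP; exists r0.
case: (ex_minnP exP) => k /asboolP[r er sr] m; exists r; split=> // r' er'.
by rewrite sr; apply: m; apply/asboolP; exists r'.
Qed.

(* Main.v *)
(* Modulo monomials with a smaller sum of squared exponents, which span a
   submodule, pibar_i sends x^m to s_i x^m, 0 or - x^m according as m_i is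
   greater than, equal to or less than m_(i+1).  Sending a filling to the
   monomial whose exponent of x_k decreases with the row of k thus turns the
   action on M_alpha into the leading part of the action on polynomials, and
   h x_alpha |-> h tau_0 is a well defined surjection H x_alpha -> M_alpha, with
   tau_0 the filling whose rows are consecutive intervals.  It maps pibar_w x_alpha to the filling
   w o tau_0; these are the basis of M_alpha when D(w) is contained in D(alpha).
   Conversely, pibar_j x_alpha = 0 for j outside D(alpha), together with
   Matsumoto's theorem, shows that the pibar_w x_alpha with D(w) contained in
   D(alpha) span H x_alpha. *)
Require Import Defs.
From HB Require Import structures.
From mathcomp Require Import all_boot all_order all_algebra all_fingroup.
From mathcomp Require Import boolp mpoly.
From mathcomp Require Import ring zify.

Set Implicit Arguments.
Unset Strict Implicit.
Unset Printing Implicit Defensive.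

Import GRing.Theory.
Local Open Scope ring_scope.

(** * Inversions, reduced words and Matsumoto's theorem *)

Section Inversions.
Variable n : nat.
Implicit Types (i j : 'I_n.-1) (w : 'S_n) (r : seq 'I_n.-1).

Definition inversions w : {set 'I_n * 'I_n} :=
  [set p : 'I_n * 'I_n | (p.1 < p.2)%N && (w p.2 < w p.1)%N].

(** Products in ['S_n] apply the left factor first, so [w * adj i] is s_i w; a left descent is an i
    for which s_i w is shorter than w. *)
Definition left_descent w i : bool := (w^-1%g (hi i) < w^-1%g (lo i))%N.

Lemma left_ascent w i : ~~ left_descent w i = (w^-1%g (lo i) < w^-1%g (hi i))%N.
Proof.
rewrite -leqNgt leq_eqVlt (inj_eq val_inj) (inj_eq perm_inj).
by rewrite (negPf (lo_neq_hi i)).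
Qed.

Lemma adj_mulK w i : (w * adj i * adj i)%g = w.
Proof. by rewrite -mulgA tperm2 mulg1. Qed.

Lemma adj_invE w i x : ((w * adj i)^-1)%g x = w^-1%g (adj i x).
Proof. by rewrite invMg permM tpermV. Qed.

Lemma left_descent_adj w i : left_descent (w * adj i)%g i = ~~ left_descent w i.
Proof. by rewrite left_ascent /left_descent !adj_invE tpermL tpermR. Qed.

Lemma adj_ltn i (x y : 'I_n) : ~~ ((x == lo i) && (y == hi i)) ->
  ~~ ((x == hi i) && (y == lo i)) -> (adj i x < adj i y)%N = (x < y)%N.
Proof.
rewrite /adj; case: tpermP => [->|->|/eqP x1 /eqP x2];
  case: tpermP => [->|->|/eqP y1 /eqP y2]; rewrite ?eqxx //= ?ltnn //;
  move: x1 x2 y1 y2 || move: x1 x2 || move: y1 y2 || idtac;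
  do 6?[rewrite -val_eqE /=]; lia.
Qed.

(** Exchanging the consecutive values [lo i] and [hi i] changes the relative order of no other pair
    of values, so the only new inversion is the pair [p] of their positions. *)
Lemma card_inversions_adj w i : ~~ left_descent w i ->
  #|inversions (w * adj i)%g| = #|inversions w|.+1.
Proof.
move=> asc; have lt : (w^-1%g (lo i) < w^-1%g (hi i))%N by rewrite -left_ascent.
set p := (w^-1%g (lo i), w^-1%g (hi i)).
have wE x z : (w x == z) = (x == w^-1%g z).
  by apply/eqP/eqP=> [<-|->]; rewrite ?permK ?permKV.
have pn : p \notin inversions w.
  by rewrite inE /p /= !permKV /=; lia.
rewrite -add1n -[1%N]/(true : nat) -pn -cardsU1; congr #|pred_of_set _|.
apply/setP=> -[x y]; rewrite !inE !permM xpair_eqE /=.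
case: (boolP ((w x == lo i) && (w y == hi i))) => [/andP[/eqP ex /eqP ey]|h1].
  rewrite ex ey tpermL tpermR -[x](permK w) -[y](permK w) ex ey !eqxx lt /=; lia.
case: (boolP ((w y == lo i) && (w x == hi i))) => [/andP[/eqP ey /eqP ex]|h2].
  rewrite ex ey tpermL tpermR -[x](permK w) -[y](permK w) ex ey.
  rewrite (inj_eq perm_inj) [hi i == _]eq_sym (negPf (lo_neq_hi i)) /=; lia.
rewrite -!wE (negPf h1) /= adj_ltn //.
by rewrite andbC.
Qed.

Lemma card_inversions_descent w i : left_descent w i ->
  #|inversions w| = #|inversions (w * adj i)%g|.+1.
Proof.
by move=> d; rewrite -{1}(adj_mulK w i) card_inversions_adj ?left_descent_adj ?negbK.
Qed.

Lemma inversions1 : inversions 1%g = set0.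
Proof. by apply/setP=> p; rewrite !inE !perm1 ltnNge; case: ltngtP. Qed.

Lemma card_inversions_word r : (#|inversions (word_perm r)| <= size r)%N.
Proof.
elim: r => [|i r IH] /=; first by rewrite inversions1 cards0.
have [d|a] := boolP (left_descent (word_perm r) i); last by rewrite card_inversions_adj.
rewrite (card_inversions_descent d) in IH; exact: leqW (ltnW IH).
Qed.

Lemma no_left_descent w : (forall i, ~~ left_descent w i) -> w = 1%g.
Proof.
move=> asc; apply/invg_inj; rewrite invg1.
(* Without left descents the inverse of w gains at least 1 at each step; applied from 0 to x and
   from x to n - 1, this bounds its value at x by x from both sides. *)
have mono d (x y : 'I_n) : (y = x + d :> nat)%N -> (w^-1%g x + d <= w^-1%g y)%N.
  elim: d y => [|d IH] y e.
    by rewrite addn0; have -> : x = y by apply: val_inj; rewrite /= e addn0.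
  have ly := ltn_ord y; have li : (x + d < n.-1)%N by lia.
  have := asc (Ordinal li); rewrite left_ascent.
  have -> : hi (Ordinal li) = y by apply: val_inj => /=; lia.
  by have := IH (lo (Ordinal li)) erefl; lia.
apply/permP=> x; rewrite perm1; apply: val_inj => /=.
have lx := ltn_ord x.
have n0 : (0 < n)%N by lia.
have l1 : (n.-1 < n)%N by lia.
have := mono x (Ordinal n0) x erefl.
have h : (Ordinal l1 = x + (n.-1 - x) :> nat)%N by move=> /=; lia.
have := mono _ _ _ h; have := ltn_ord (w^-1%g (Ordinal l1)).
by clear; move: (w^-1%g (Ordinal l1)) (w^-1%g (Ordinal n0)) (w^-1%g x) => a b c; lia.
Qed.

Lemma exists_short_word w : exists2 r, word_perm r = w & size r = #|inversions w|.
Proof.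
have [k] := ubnP #|inversions w|; elim: k w => // k IH w lk.
have [/existsP[i d]|/existsPn a] := boolP [exists i, left_descent w i]; last first.
  by exists [::]; rewrite (no_left_descent a) ?inversions1 ?cards0.
move: lk; rewrite (card_inversions_descent d) ltnS => /IH[r er sr].
by exists (i :: r); rewrite /= ?er ?adj_mulK ?sr.
Qed.

(** The inversion number bounds the length of every word from below, and is attained by removing
    left descents one at a time. *)
Lemma reducedP r w :
  reduced_expression r w <-> word_perm r = w /\ size r = #|inversions w|.
Proof.
split=> [[e m]|[e s]]; split=> //.
  have [r' er' sr'] := exists_short_word w.
  by apply/eqP; rewrite eqn_leq -{1}sr' m //= -e card_inversions_word.
by move=> r' e'; rewrite s -e'; apply: card_inversions_word.
Qed.

Lemma reduced_cons i r w : reduced_expression (i :: r) w ->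
  left_descent w i /\ reduced_expression r (w * adj i)%g.
Proof.
move=> /reducedP[e s]; have er : word_perm r = (w * adj i)%g by rewrite -e /= adj_mulK.
have d : left_descent w i.
  apply/negPn/negP=> /card_inversions_adj h.
  by have := card_inversions_word r; rewrite er h -s ltnNge leqnSn.
split=> //; apply/reducedP; split=> //.
by move: s; rewrite (card_inversions_descent d) => -[].
Qed.

Lemma cons_reduced i r w : left_descent w i -> reduced_expression r (w * adj i)%g ->
  reduced_expression (i :: r) w.
Proof.
move=> d /reducedP[e s]; apply/reducedP; split; first by rewrite /= e adj_mulK.
by rewrite /= s (card_inversions_descent d).
Qed.

(* When the first letters i and j differ, both are left descents of w, so the
   two words are compared through reduced words of w that begin with the two
   sides of the relation between i and j. *)
Lemma matsumoto (A : pzSemiRingType) (g : 'I_n.-1 -> A) :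
  (forall i j, (i.+1 < j)%N -> g i * g j = g j * g i) ->
  (forall i j, i.+1 = j -> g i * g j * g i = g j * g i * g j) ->
  forall r r' w, reduced_expression r w -> reduced_expression r' w ->
  \prod_(i <- r) g i = \prod_(i <- r') g i.
Proof.
move=> gC gB r; have [k] := ubnP (size r); elim: k r => // k IH r.
case: r => [|i u] lk r' w Rr Rr'.
  case: Rr' => _ /(_ [::]); case: Rr => -> _ /(_ erefl).
  by rewrite leqn0 => /nilP ->.
case: r' Rr' => [|j u'] Rr'.
  by case: Rr => _ /(_ [::]); case: Rr' => -> _ /(_ erefl).
have szE : size u' = size u.
  by case/reducedP: Rr => _ er; case/reducedP: Rr' => _; rewrite -er => -[].
wlog ij : i j u u' szE lk Rr Rr' / (i <= j)%N.
  move=> H; case: (leqP i j) => [|/ltnW] ij; first exact: H.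
  by apply/esym/H => //; rewrite /= szE.
have [di Ru] := reduced_cons Rr; have [dj Ru'] := reduced_cons Rr'.
have conv a x z : (size x < k)%N -> reduced_expression x (w * adj a)%g ->
    reduced_expression z (w * adj a)%g ->
    \prod_(i <- a :: x) g i = \prod_(i <- a :: z) g i.
  by move=> lx Rx Rz; rewrite !big_cons; congr (_ * _); apply: IH Rx Rz.
have lu : (size u < k)%N by [].
have lu' : (size u' < k)%N by rewrite szE.
case: (ltngtP i j) ij => // [ij _|/val_inj eij _]; last first.
  by subst j; apply: conv Ru Ru'.
have [z Rz] := reduced_expression_ex (w * adj i * adj j)%g.
have d1 := lo_neq_hi i; have d2 := lo_neq_hi j.
have d3 : lo i != hi j by rewrite -val_eqE /=; apply/eqP; lia.
case: (ltngtP i.+1 j) ij => // [ij _|eij _].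
  have d x y : (x \in [:: lo i; hi i]) -> (y \in [:: lo j; hi j]) -> x != y.
    by rewrite !inE => /orP[]/eqP-> /orP[]/eqP->; rewrite -val_eqE /=; apply/eqP; lia.
  have e1 : adj i (lo j) = lo j by rewrite tpermD // d // !inE eqxx ?orbT.
  have e2 : adj i (hi j) = hi j by rewrite tpermD // d // !inE eqxx ?orbT.
  have e3 : adj j (lo i) = lo i by rewrite tpermD // eq_sym d // !inE eqxx ?orbT.
  have e4 : adj j (hi i) = hi i by rewrite tpermD // eq_sym d // !inE eqxx ?orbT.
  have R1 : reduced_expression (j :: z) (w * adj i)%g.
    by apply: cons_reduced => //; rewrite /left_descent !adj_invE e1 e2.
  have R2 : reduced_expression (i :: z) (w * adj j)%g.
    apply: cons_reduced; last by rewrite -mulgA -adj_far ?mulgA.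
    by rewrite /left_descent !adj_invE e3 e4.
  rewrite (conv _ _ _ lu Ru R1) (conv _ _ _ lu' Ru' R2) !big_cons !mulrA.
  by rewrite gC.
have e := lo_next eij.
have t1 : adj i (lo i) = hi i by rewrite tpermL.
have t2 : adj i (hi i) = lo i by rewrite tpermR.
have t3 : adj i (hi j) = hi j by rewrite tpermD // -e.
have t4 : adj j (lo i) = lo i by rewrite tpermD // eq_sym // e.
have t5 : adj j (hi i) = hi j by rewrite -e tpermL.
have t6 : adj j (hi j) = hi i by rewrite tpermR e.
have [y Ry] := reduced_expression_ex (w * adj i * adj j * adj i)%g.
(* The inverse of w decreases along [lo i], [hi i], [hi j], so each letter of either braid word is a
   left descent at the moment it is removed. *)
rewrite /left_descent e in dj; rewrite /left_descent in di.
have R1 : reduced_expression (j :: i :: y) (w * adj i)%g.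
  apply: cons_reduced; first by rewrite /left_descent !adj_invE e t2 t3; lia.
  by apply: cons_reduced => //; rewrite /left_descent !adj_invE t4 t5 t1 t3.
have R2 : reduced_expression (i :: j :: y) (w * adj j)%g.
  apply: cons_reduced; first by rewrite /left_descent !adj_invE t4 t5; lia.
  apply: cons_reduced; first by rewrite /left_descent !adj_invE e t2 t3 t4 t6.
  by move: Ry; rewrite -!mulgA [(adj i * _)%g]mulgA adj_braid // -!mulgA.
rewrite (conv _ _ _ lu Ru R1) (conv _ _ _ lu' Ru' R2) !big_cons !mulrA.
by rewrite gB.
Qed.

End Inversions.

(** * Relations of H_n(0) in the generators [hpibar] *)

Section HeckeRelations.
Variables (F : fieldType) (n : nat).
Implicit Types i j : 'I_n.-1.

Lemma hpi_idem i : hpi F i * hpi F i = hpi F i.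
Proof. by rewrite -hclassM; apply/heqE/heq_idem. Qed.

Lemma mulr_sub1 (R : pzRingType) (a b : R) : (a - 1) * (b - 1) = a * b - (a + b) + 1.
Proof. by rewrite mulrBr mulr1 mulrBl mul1r opprB [a + b]addrC opprD !addrA addrAC. Qed.

Lemma hpibar_comm i j : (i.+1 < j)%N ->
  hpibar F i * hpibar F j = hpibar F j * hpibar F i.
Proof.
move=> ij; have e : hpi F i * hpi F j = hpi F j * hpi F i.
  by rewrite /hpi -!hclassM; apply/heqE/heq_comm.
by rewrite /hpibar !mulr_sub1 e [hpi F i + _]addrC.
Qed.

Lemma hpibar_braid i j : i.+1 = j ->
  hpibar F i * hpibar F j * hpibar F i = hpibar F j * hpibar F i * hpibar F j.
Proof.
move=> ij; have e : hpi F i * hpi F j * hpi F i = hpi F j * hpi F i * hpi F j.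
  by rewrite /hpi -!hclassM; exact: heqE (heq_braid F ij).
(* For idempotent a and b, all terms but a b a are symmetric in a and b, so the braid relation
   passes from the pi_i to the pibar_i. *)
have expand (a b : hecke0 F n) : a * a = a ->
    (a - 1) * (b - 1) * (a - 1) = a * b * a - (b * a + a * b) + (a + b) - 1.
  move=> aa; rewrite mulr_sub1 mulrBr mulr1 mulrDl mul1r mulrBl mulrDl aa.
  rewrite [a + b * a]addrC opprD addrA subrK.
  rewrite opprD opprB [b * a + _]addrC opprD [_ - a * b]addrC !addrA.
  by congr (_ + _ + _ - _); rewrite addrAC.
rewrite /hpibar !expand ?hpi_idem // e.
by rewrite [hpi F j * hpi F i + _]addrC [hpi F j + _]addrC.
Qed.

Lemma hpibar_sqr i : hpibar F i * hpibar F i = - hpibar F i.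
Proof. by rewrite /hpibar mulrBr mulr1 mulrBl hpi_idem mul1r subrr sub0r. Qed.

Lemma hpibar_word_cons i r :
  hpibar_word F (i :: r) = hpibar F i * hpibar_word F r.
Proof. by rewrite /hpibar_word big_cons. Qed.

End HeckeRelations.

(** * Leading terms of the Demazure operators *)

Section Filtration.
Variables (F : fieldType) (n : nat).
Implicit Types (f g : {mpoly F[n]}) (i j : 'I_n.-1) (m : 'X_{1..n}).

Definition sumsq m : nat := (\sum_(k < n) m k ^ 2)%N.

(** The span of the monomials of weight [sumsq] below s. This weight is invariant under permuting
    exponents and strictly convex. *)
Definition low (s : nat) f : Prop := forall m, (s <= sumsq m)%N -> f@_m = 0.

Lemma low0 s : low s 0.
Proof. by move=> m _; rewrite mcoeff0. Qed.

Lemma lowD s f g : low s f -> low s g -> low s (f + g).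
Proof. by move=> lf lg m sm; rewrite mcoeffD lf ?lg ?addr0. Qed.

Lemma lowZ s c f : low s f -> low s (c *: f).
Proof. by move=> lf m sm; rewrite mcoeffZ lf ?mulr0. Qed.

Lemma lowN s f : low s f -> low s (- f).
Proof. by move=> lf m sm; rewrite mcoeffN lf ?oppr0. Qed.

Lemma low_sum s (I : Type) (r : seq I) (P : pred I) (G : I -> {mpoly F[n]}) :
  (forall k, P k -> low s (G k)) -> low s (\sum_(k <- r | P k) G k).
Proof. by move=> lG; apply: big_ind => //; [apply: low0 | apply: lowD]. Qed.

Lemma lowW s t f : (s <= t)%N -> low s f -> low t f.
Proof. by move=> st lf m tm; apply/lf/(leq_trans st). Qed.

Lemma lowX s m : (sumsq m < s)%N -> low s 'X_[m].
Proof. by move=> ms m' sm'; rewrite mcoeffX; case: eqP => // e; subst m'; lia. Qed.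

Definition demazure_bar i f : {mpoly F[n]} := demazure i f - f.

Lemma demazure_bar_linear i : linear (demazure_bar i).
Proof.
move=> a f g; rewrite /demazure_bar demazure_linear scalerBr opprD.
by rewrite -!addrA; congr (_ + _); rewrite addrCA.
Qed.

HB.instance Definition _ i := GRing.isLinear.Build F {mpoly F[n]} {mpoly F[n]}
  _ (demazure_bar i) (demazure_bar_linear i).

(** Isolates the exponents of the two variables on which pibar_i acts; the cofactor [reset m i 0 0]
    is fixed by s_i. *)
Definition reset m i (p q : nat) : 'X_{1..n} :=
  [multinom if k == lo i then p else if k == hi i then q else m k | k < n].

Lemma reset_id m i : reset m i (m (lo i)) (m (hi i)) = m.
Proof.
by apply/mnmP=> k; rewrite mnmE; case: eqP => [->//|_]; case: eqP => [->|].
Qed.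

Definition mperm m i : 'X_{1..n} := [multinom m (adj i k) | k < n].

Lemma reset_swap m i : reset m i (m (hi i)) (m (lo i)) = mperm m i.
Proof.
apply/mnmP=> k; rewrite !mnmE /adj.
case: tpermP => [->|->|/eqP/negPf-> /eqP/negPf->] //; rewrite eqxx //.
by rewrite eq_sym (negPf (lo_neq_hi i)).
Qed.

Lemma sumsq_reset m i p q :
  sumsq (reset m i p q) = (sumsq (reset m i 0 0) + p ^ 2 + q ^ 2)%N.
Proof.
have d := lo_neq_hi i; have d' : hi i != lo i by rewrite eq_sym.
rewrite /sumsq (bigD1 (lo i)) // (bigD1 (hi i)) //=.
rewrite [X in _ = (X + _ + _)%N](bigD1 (lo i)) // (bigD1 (hi i)) //=.
rewrite !mnmE !eqxx (negPf d'); set A := (\sum_(_ < _ | _) _)%N.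
set B := (\sum_(_ < _ | _) _)%N; have -> : A = B.
  by apply: eq_bigr => k /andP[/negPf k1 /negPf k2]; rewrite !mnmE k1 k2.
lia.
Qed.

Lemma mpolyX_reset m i p q : 'X_[reset m i p q] =
  'X_[reset m i 0 0] * 'X_(lo i) ^+ p * 'X_(hi i) ^+ q :> {mpoly F[n]}.
Proof.
have d := lo_neq_hi i; have d' : hi i != lo i by rewrite eq_sym.
rewrite !mpolyXn -!mpolyXD; congr 'X_[_]; apply/mnmP=> k.
rewrite !(mnmE, mnmDE, mulmnE, mnm1E) [lo i == k]eq_sym [hi i == k]eq_sym.
by case: eqP => [->|_]; rewrite ?(negPf d) ?(negPf d'); [|case: eqP => _]; lia.
Qed.

Lemma msym_reset00 m i :
  msym (adj i) 'X_[reset m i 0 0] = 'X_[reset m i 0 0] :> {mpoly F[n]}.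
Proof.
have d := lo_neq_hi i; have d' : hi i != lo i by rewrite eq_sym.
rewrite /msym mmapX /mmap1 [RHS]mpolyXE_id; apply/esym.
rewrite (reindex_inj (h := adj i)) /=; last exact: perm_inj.
apply: eq_bigr => k _; congr (_ ^+ _); rewrite !mnmE /adj.
by case: tpermP => [->|->|/eqP/negPf-> /eqP/negPf->]; rewrite ?eqxx ?(negPf d').
Qed.

(** The formula pibar_i f = x_(i+1) (f - s_i f) / (x_i - x_(i+1)), free of division. *)
Lemma demazure_bar_eq i f g : g * ('X_(lo i) - 'X_(hi i)) =
  'X_(hi i) * (f - msym (adj i) f) -> demazure_bar i f = g.
Proof.
move=> e; apply: (mulIf (mvarB_neq0 F (lo_neq_hi i))).
by rewrite e mulrBl demazureE; ring.
Qed.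

(** The geometric sum (x_i^d - x_(i+1)^d) / (x_i - x_(i+1)), times x_i^b x_(i+1)^(b+1) and the
    monomial of [reset m i 0 0]. *)
Definition interp_sum m i b d : {mpoly F[n]} :=
  \sum_(k < d) 'X_[reset m i (b + (d.-1 - k)) (b.+1 + k)].

Lemma interp_sumE m i b d :
  interp_sum m i b d * ('X_(lo i) - 'X_(hi i)) =
  'X_[reset m i 0 0] * 'X_(lo i) ^+ b * 'X_(hi i) ^+ b.+1 *
  ('X_(lo i) ^+ d - 'X_(hi i) ^+ d).
Proof.
rewrite subrXX [RHS]mulrCA [RHS]mulrC; congr (_ * _).
rewrite /interp_sum mulr_sumr; apply: eq_bigr => k _.
by rewrite mpolyX_reset !exprD; ring.
Qed.

Lemma msym_reset m i p q :
  msym (adj i) 'X_[reset m i p q] = 'X_[reset m i q p] :> {mpoly F[n]}.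
Proof.
rewrite mpolyX_reset [RHS]mpolyX_reset !msymM msym_reset00 !rmorphXn /=.
by rewrite !msym_var tpermL tpermR; ring.
Qed.

Lemma demazure_bar_desc m i b d :
  demazure_bar i 'X_[reset m i (b + d) b] = interp_sum m i b d.
Proof.
apply: demazure_bar_eq; rewrite interp_sumE msym_reset.
by rewrite (mpolyX_reset m i (b + d)) (mpolyX_reset m i b) !exprD exprS; ring.
Qed.

Lemma demazure_bar_asc m i b d :
  demazure_bar i 'X_[reset m i b (b + d)] = - interp_sum m i b d.
Proof.
apply: demazure_bar_eq; rewrite mulNr interp_sumE msym_reset.
by rewrite (mpolyX_reset m i (b + d)) (mpolyX_reset m i b) !exprD exprS; ring.
Qed.

(** The monomial removed is the last term of the sum. In the others the two exponents have the same
    sum 2b + d but lie strictly between b and b + d, so the weight is smaller by convexity. *)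
Lemma low_interp_sum m i b d : (0 < d)%N ->
  low (sumsq (reset m i b (b + d))) (interp_sum m i b d - 'X_[reset m i b (b + d)]).
Proof.
case: d => // d _; rewrite /interp_sum big_ord_recr /= subnn addn0 addSnnS addrK.
apply: low_sum => k _; apply: lowX; rewrite [ltnLHS]sumsq_reset [ltnRHS]sumsq_reset.
have := ltn_ord k; rewrite -!addnA ltn_add2l => lk.
have -> : (b + (d - k) = b + (d - k.+1).+1)%N by lia.
have e : (d = k + (d - k.+1).+1)%N by lia.
move: (d - k.+1)%N (k : nat) e => c l ->; nia.
Qed.

Lemma sumsq_mperm m i : sumsq (mperm m i) = sumsq m.
Proof.
rewrite -reset_swap -[in RHS](reset_id m i) sumsq_reset [RHS]sumsq_reset; lia.
Qed.

Lemma demazure_bar_gt m i : (m (hi i) < m (lo i))%N ->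
  low (sumsq m) (demazure_bar i 'X_[m] - 'X_[mperm m i]).
Proof.
move=> lt; have e : (m (lo i) = m (hi i) + (m (lo i) - m (hi i)))%N by lia.
rewrite -{2}(reset_id m i) [in X in reset m i X _]e demazure_bar_desc.
rewrite -(sumsq_mperm m i) -reset_swap; rewrite [in X in reset m i _ X]e.
by apply: low_interp_sum; lia.
Qed.

Lemma demazure_bar_eq0 m i : m (hi i) = m (lo i) -> demazure_bar i 'X_[m] = 0.
Proof.
move=> e; rewrite -(reset_id m i) e -[X in reset m i X _]addn0 demazure_bar_desc.
by rewrite /interp_sum big_ord0.
Qed.

Lemma demazure_bar_lt m i : (m (lo i) < m (hi i))%N ->
  low (sumsq m) (demazure_bar i 'X_[m] + 'X_[m]).
Proof.
move=> lt; have e : (m (hi i) = m (lo i) + (m (hi i) - m (lo i)))%N by lia.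
rewrite -(reset_id m i) e demazure_bar_asc -[X in low _ X]opprK opprD opprK.
by apply/lowN/low_interp_sum; lia.
Qed.

(** In each of the three cases pibar_i sends a monomial to terms of at most the same weight, so
    leading terms modulo [low s] carry an action. *)
Lemma low_demazure_bar s i f : low s f -> low s (demazure_bar i f).
Proof.
move=> lf; rewrite [f]mpolyE linear_sum; apply: low_sum => m _.
rewrite linearZ /=; case: (leqP s (sumsq m)) => [/lf->|lt].
  by rewrite scale0r; apply: low0.
apply: lowZ; have lm := lowX lt.
have [h|h|h] := ltngtP (m (lo i)) (m (hi i)).
- rewrite -[demazure_bar _ _](addrK 'X_[m]); apply: lowD (lowN lm).
  exact: lowW (ltnW lt) (demazure_bar_lt h).
- rewrite -[demazure_bar _ _](subrK 'X_[mperm m i]).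
  apply: lowD; first exact: lowW (ltnW lt) (demazure_bar_gt h).
  by apply: lowX; rewrite sumsq_mperm.
- by rewrite demazure_bar_eq0 //; apply: low0.
Qed.

End Filtration.

(** * The standard filling and the permutations w with D(w) in D(alpha) *)

Section StandardFilling.
Variables (n : nat) (alpha : seq nat).
Hypothesis halpha : is_composition n alpha.
Let D := comp_descents n alpha.

(** Row r of the standard filling runs from [psum r] up to, but excluding, [psum r.+1]. *)
Definition psum (r : nat) : nat := sumn (take r alpha).

Lemma psumS r : psum r.+1 = (psum r + nth 0%N alpha r)%N.
Proof.
rewrite /psum; case: (ltnP r (size alpha)) => h.
  by rewrite (take_nth 0%N) // sumn_rcons.
by rewrite !take_oversize ?nth_default ?addn0 // ltnW.
Qed.

Lemma psum_size : psum (size alpha) = n.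
Proof. by rewrite /psum take_size; case/andP: halpha => _ /eqP. Qed.

Lemma psum_leq r s : (r <= s)%N -> (psum r <= psum s)%N.
Proof.
move=> /subnK <-; elim: (s - r)%N => // k IH.
by rewrite addSn psumS; apply: leq_trans IH (leq_addr _ _).
Qed.

Lemma psum_ltn r s : (r < s)%N -> (s <= size alpha)%N -> (psum r < psum s)%N.
Proof.
move=> rs ss; apply: leq_trans (psum_leq rs); rewrite psumS -addn1 leq_add2l lt0n.
case/andP: halpha => /negP h _; apply/negP=> /eqP e; apply: h; rewrite -e mem_nth //.
exact: leq_trans rs ss.
Qed.

Lemma psum_cell_lt (c : cell alpha) : (psum (tag c) + tagged c < n)%N.
Proof.
rewrite -psum_size; have := psum_leq (ltn_ord (tag c)); rewrite psumS.
by apply: leq_trans; rewrite ltn_add2l.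
Qed.

Definition std_fun : {ffun cell alpha -> 'I_n} := [ffun c => Ordinal (psum_cell_lt c)].

(* The row of the standard filling containing k, counted by the row ends
   preceding k. *)
Definition std_row (k : nat) : nat := #|[set j in D | (j < k)%N]|.

Lemma std_row_psum r a : (r < size alpha)%N -> (a < nth 0%N alpha r)%N ->
  std_row (psum r + a) = r.
Proof.
move=> rs ar.
have lt (k : 'I_r) : ((psum k.+1).-1 < n.-1)%N.
  have h1 : (psum 0 < psum k.+1)%N by apply: psum_ltn => //; have := ltn_ord k; lia.
  have h2 : (psum k.+1 < psum (size alpha))%N.
    by apply: psum_ltn => //; have := ltn_ord k; lia.
  by move: h1 h2; rewrite psum_size; lia.
(* [h k] is the end of row k, with the shift by one of the elements of D. For k < r these are
   exactly the elements of D before [psum r + a]. *)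
pose h (k : 'I_r) := Ordinal (lt k).
have hS k : (h k).+1 = psum k.+1.
  rewrite /= prednK //; apply: leq_ltn_trans (leq0n (psum 0)) _.
  by apply: psum_ltn => //; have := ltn_ord k; lia.
have injh : injective h.
  move=> k l e; apply: val_inj => /=; have := hS k; rewrite e hS => {}e.
  have := ltn_ord k; have := ltn_ord l.
  case: (ltngtP k l) => // kl ? ?.
    by have := @psum_ltn k.+1 l.+1 kl; lia.
  by have := @psum_ltn l.+1 k.+1 kl; lia.
rewrite /std_row -[RHS]card_ord -(card_imset _ injh); apply: eq_card => j.
rewrite !inE; apply/andP/imsetP.
  case=> /mapP[k]; rewrite mem_iota => /andP[k0 ks] e; rewrite -/(psum k) in e.
  rewrite ltnNge => lj.
  have kr : (k.-1 < r)%N.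
    rewrite prednK // leqNgt; apply/negP=> rk; have := psum_leq rk.
    by rewrite psumS -e; lia.
  exists (Ordinal kr) => //; apply: val_inj; apply: succn_inj.
  by rewrite hS /= prednK.
case=> k _ ->; split.
  apply/mapP; exists k.+1; last exact: hS.
  by rewrite mem_iota /=; have := ltn_ord k; lia.
have := hS k; have := @psum_leq k.+1 r (ltn_ord k); lia.
Qed.

Lemma std_row_cell (c : cell alpha) : std_row (std_fun c) = tag c.
Proof. by rewrite ffunE /= std_row_psum. Qed.

Lemma std_fun_inj : injective std_fun.
Proof.
move=> [r a] [s b] e; have ers : r = s.
  by apply: val_inj; have := std_row_cell (existT _ r a); rewrite e std_row_cell.
subst s; congr existT; apply: val_inj.
by move/(congr1 (@nat_of_ord n)): e; rewrite !ffunE /= => /addnI.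
Qed.

Lemma card_cell : #|cell alpha| = n.
Proof.
rewrite card_tagged -[RHS](eqP (proj2 (andP halpha))); congr sumn.
apply: (@eq_from_nth _ 0%N); first by rewrite size_map size_enum_ord.
move=> k; rewrite size_map size_enum_ord => lk.
by rewrite (nth_map (Ordinal lk)) ?size_enum_ord // card_ord nth_enum_ord.
Qed.

Lemma std_funP : is_filling std_fun.
Proof.
have [g fK gK] : bijective std_fun.
  by apply: inj_card_bij std_fun_inj _; rewrite card_cell card_ord.
apply/andP; split.
  apply/forallP=> k; apply/cards1P; exists (g k); apply/setP=> c.
  by rewrite !inE; apply/eqP/eqP=> [<-|->].
apply/forallP=> r; apply/forallP=> a; apply/forallP=> b; apply/implyP=> ab.
by rewrite !ffunE /= ltn_add2l.
Qed.

Definition std_filling : filling n alpha := Filling std_funP.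

Lemma row_of_std k : row_of std_filling k = std_row k.
Proof.
by have [c /eqP <-] := filling_ex std_filling k; rewrite row_ofE; apply/esym/std_row_cell.
Qed.

Lemma std_row_mono k l : (k <= l)%N -> (std_row k <= std_row l)%N.
Proof.
move=> kl; apply/subset_leq_card/subsetP=> j; rewrite !inE => /andP[-> jk].
exact: leq_trans jk kl.
Qed.

(** Thus [lo j] and [hi j] share a row of the standard filling exactly when j is not in D. *)
Lemma std_rowS (j : 'I_n.-1) : std_row j.+1 = (std_row j + (j \in D))%N.
Proof.
rewrite /std_row (cardsD1 j) addnC; congr (_ + _)%N; last by rewrite !inE ltnSn andbT.
apply: eq_card=> k; rewrite 3!inE [RHS]inE ltnS [(k <= j)%N]leq_eqVlt (inj_eq val_inj).
by case: eqVneq => [->|] //; rewrite ltnn !andbF.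
Qed.

Lemma std_row_le k : (std_row k <= #|D|)%N.
Proof. by apply/subset_leq_card/subsetP=> j; rewrite inE => /andP[]. Qed.

(** Equivalently, w is increasing on each row of the standard filling, that is, w o tau_0 is a
    filling. *)
Definition grassmannian (w : 'S_n) : bool := descents w \subset D.

(** Row indices are monotone, so all positions from x to y lie in one row; no step between them is
    at an element of D, hence none is a descent. *)
Lemma grassmannian_lt w (x y : 'I_n) : grassmannian w ->
  (x < y)%N -> std_row x = std_row y -> (w x < w y)%N.
Proof.
move=> gw xy exy; have [d ed] : exists d, (y = x + d.+1 :> nat)%N.
  by exists (y - x).-1; lia.
move: exy; rewrite ed => exy.
have {exy} : (std_row (x + d.+1) <= std_row x)%N by rewrite exy.
elim: d y ed {xy} => [|d IH] y ed lexy; have ly := ltn_ord y.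
all: have lj : (y.-1 < n.-1)%N by lia.
all: pose j := Ordinal lj.
all: have ej : hi j = y by apply: val_inj => /=; lia.
all: have := @std_row_mono x j; have := std_rowS j.
all: have -> : j.+1 = y by rewrite /=; lia.
all: rewrite ed => s1 s2.
all: have jD : j \notin D by rewrite /= in s1 s2 *; case: (j \in D) s1 s2; lia.
all: have : j \notin descents w by apply: contra jD => /(subsetP gw).
all: rewrite inE -leqNgt leq_eqVlt (inj_eq val_inj) (inj_eq perm_inj).
all: rewrite (negPf (lo_neq_hi _)) ej /=.
  by have -> : lo j = x by apply: val_inj => /=; lia.
have elo : (lo j = x + d.+1 :> nat)%N by rewrite /=; lia.
apply: ltn_trans; apply: (IH _ elo); rewrite -elo; apply: leq_trans lexy.
by apply: std_row_mono; rewrite /=; lia.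
Qed.

Definition acts_as (w : 'S_n) (tau : filling n alpha) : Prop :=
  forall c, tau c = w (std_filling c).

Lemma acts_as_row w tau k : acts_as w tau ->
  row_of tau k = std_row (w^-1%g k).
Proof.
move=> a; have [c /eqP <-] := filling_ex tau k.
by rewrite row_ofE a permK -row_of_std row_ofE.
Qed.

Lemma acts_as_inj w u tau : acts_as w tau -> acts_as u tau -> w = u.
Proof.
move=> aw au; apply/permP=> k; have [c /eqP <-] := filling_ex std_filling k.
by rewrite -aw -au.
Qed.

Lemma acts_as_eq w tau sigma : acts_as w tau -> acts_as w sigma -> tau = sigma.
Proof. by move=> at_ as_; apply/val_inj/ffunP=> c; rewrite /= at_ as_. Qed.

(** Let w send the standard entry of each cell to its entry in tau. For j outside D, [lo j] and
    [hi j] lie in one row, and increasing rows exclude a descent at j. *)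
Lemma filling_acts_as tau : exists2 w, grassmannian w & acts_as w tau.
Proof.
pose g k := xchoose (filling_ex std_filling k).
have gK k : std_filling (g k) = k by apply/eqP/(xchooseP (filling_ex std_filling k)).
have injg : injective (fun k => tau (g k)).
  by move=> k l /filling_inj e; rewrite -[k]gK e gK.
have aw : acts_as (perm injg) tau.
  move=> c; rewrite permE; congr (tau _).
  by apply: (@filling_inj _ _ std_filling); rewrite gK.
exists (perm injg) => //; apply/subsetP=> j; rewrite inE; apply: contraTT => jD.
have := std_rowS j; rewrite (negPf jD) addn0 -leqNgt => e; apply: ltnW.
have [[r a] /eqP elo] := filling_ex std_filling (lo j).
have [[s b] /eqP ehi] := filling_ex std_filling (hi j).
have ers : r = s.
  apply: val_inj; have := row_ofE std_filling (existT _ r a).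
  have := row_ofE std_filling (existT _ s b); rewrite elo ehi !row_of_std /= => <- <-.
  by rewrite e.
subst s; have ab : (a < b)%N.
  have : (lo j < hi j)%N by rewrite /=.
  by rewrite -elo -ehi !ffunE /= ltn_add2l.
rewrite -elo -ehi -!aw; case/andP: (fillingP tau) => _ /forallP/(_ r).
by move=> /forallP/(_ a)/forallP/(_ b); rewrite ab.
Qed.

(** Undoing a left descent creates no descent, so the condition D(w) in D(alpha) survives removing
    the first letter of a reduced word. *)
Lemma descents_adj (w : 'S_n) i : left_descent w i ->
  descents (w * adj i)%g \subset descents w.
Proof.
move=> d; apply/subsetP=> j; rewrite !inE !permM; apply: contraTT.
rewrite -!leqNgt leq_eqVlt (inj_eq val_inj) (inj_eq perm_inj) (negPf (lo_neq_hi _)) /=.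
move=> asc; apply: ltnW; rewrite adj_ltn //; apply/negP=> /andP[/eqP e1 /eqP e2].
  by move: d; rewrite /left_descent -e1 -e2 !permK /=; lia.
by move: asc; rewrite e1 e2 /=; lia.
Qed.

Variable F : fieldType.

Lemma hpibar_word_std r w : reduced_expression r w -> grassmannian w ->
  exists2 tau, acts_as w tau &
    hpibar_word F r *: (fbase F std_filling : M_module F n alpha) = fbase F tau.
Proof.
elim: r w => [|i r IH] w.
  case=> /= <- _ _; exists std_filling; first by move=> c; rewrite perm1.
  by rewrite /hpibar_word big_nil scale1r.
move=> /reduced_cons[d Rr] gw.
have gw' := subset_trans (descents_adj d) gw.
have [tau at_ e] := IH _ Rr gw'.
(* If [lo i] and [hi i] shared a row of tau, [grassmannian_lt] for w would contradict the left
   descent i; hence pibar_i acts on tau by the swap. *)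
have lt : (row_of tau (lo i) < row_of tau (hi i))%N.
  rewrite !(acts_as_row _ at_) !adj_invE tpermL tpermR ltn_neqAle.
  rewrite std_row_mono ?andbT; last exact: ltnW.
  apply/eqP=> /(grassmannian_lt gw d); rewrite !permKV /=; lia.
exists (swap i tau).
  move=> c; rewrite swapE; last by rewrite ltn_eqF.
  by rewrite ffunE at_ permM tpermK.
rewrite hpibar_word_cons -scalerA e M_module_pibarE -Mpibar_lt // MpibarE //.
Qed.

End StandardFilling.

(** * Spanning of a cyclic module by the pibar_w with D(w) in D(alpha) *)

Section Spanning.
Variables (F : fieldType) (n : nat) (alpha : seq nat).
Variables (V : lmodType (hecke0 F n)) (v : V) (rw : 'S_n -> seq 'I_n.-1).
Hypothesis killed : forall j, j \notin comp_descents n alpha -> hpibar F j *: v = 0.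
Hypothesis rw_reduced : forall w : 'S_n, reduced_expression (rw w) w.

(** These w are the shortest representatives of the left cosets of the Young subgroup of alpha. *)
Definition cosets : finType := {w : 'S_n | descents w \subset comp_descents n alpha}.

Definition spanned (u : V) : Prop := exists c : cosets -> F,
  u = \sum_w (c w)%:A *: (hpibar_word F (rw (val w)) *: v).

Lemma spanned0 : spanned 0.
Proof. by exists (fun=> 0); rewrite big1 // => w _; rewrite !scale0r. Qed.

Lemma spannedD u u' : spanned u -> spanned u' -> spanned (u + u').
Proof.
move=> [c ->] [c' ->]; exists (fun w => c w + c' w); rewrite -big_split /=.
by apply: eq_bigr => w _; rewrite !scalerDl.
Qed.

Lemma spannedZ (a : F) u : spanned u -> spanned (a%:A *: u).
Proof.
move=> [c ->]; exists (fun w => a * c w); rewrite scaler_sumr.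
by apply: eq_bigr => w _; rewrite [LHS]scalerA mulr_algl [a *: _]scalerA.
Qed.

Lemma spanned_basis (w : 'S_n) : descents w \subset comp_descents n alpha ->
  spanned (hpibar_word F (rw w) *: v).
Proof.
move=> gw; pose w' : cosets := exist _ w gw.
exists (fun u => (u == w')%:R); rewrite (bigD1 w') //= big1 => [|u /negPf->].
  by rewrite eqxx !scale1r addr0.
by rewrite !scale0r.
Qed.

Lemma hpibar_word_reduced (r r' : seq 'I_n.-1) w : reduced_expression r w ->
  reduced_expression r' w -> hpibar_word F r = hpibar_word F r'.
Proof. exact: (matsumoto (@hpibar_comm F n) (@hpibar_braid F n)). Qed.

Lemma word_perm_cat (r s : seq 'I_n.-1) :
  word_perm (r ++ s) = (word_perm s * word_perm r)%g.
Proof. by elim: r => [|i r IH] /=; rewrite ?mulg1 // IH mulgA. Qed.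

Lemma reduced_size (w : 'S_n) : size (rw w) = #|inversions w|.
Proof. by have /reducedP[] := rw_reduced w. Qed.

(** If i is a left descent of w, then pibar_i pibar_w = - pibar_w. Otherwise the product is
    pibar_(s_i w): either it belongs to the family, or s_i w = w s_j with j outside D(alpha), and it
    equals pibar_w pibar_j, which kills v. *)
Lemma spanned_hpibar_basis i (w : 'S_n) : descents w \subset comp_descents n alpha ->
  spanned (hpibar F i *: (hpibar_word F (rw w) *: v)).
Proof.
move=> gw; have [d|nd] := boolP (left_descent w i).
  have Ru := cons_reduced d (rw_reduced _).
  rewrite (hpibar_word_reduced (rw_reduced w) Ru) hpibar_word_cons scalerA mulrA.
  rewrite hpibar_sqr mulNr -hpibar_word_cons.
  rewrite (hpibar_word_reduced Ru (rw_reduced w)) scaleNr -scaleN1r -scaleN1r.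
  exact/spannedZ/spanned_basis.
have Rw : reduced_expression (i :: rw w) (w * adj i)%g.
  by apply: cons_reduced; rewrite ?left_descent_adj // adj_mulK.
rewrite scalerA -hpibar_word_cons.
have [gu|/subsetPn[j jd jD]] :=
  boolP (descents (w * adj i)%g \subset comp_descents n alpha).
  by rewrite (hpibar_word_reduced Rw (rw_reduced _)); apply: spanned_basis.
have jw : (w (lo j) < w (hi j))%N.
  have : j \notin descents w by apply: contra jD => /(subsetP gw).
  rewrite inE -leqNgt leq_eqVlt (inj_eq val_inj) (inj_eq perm_inj).
  by rewrite (negPf (lo_neq_hi j)).
(* j is a descent of s_i w but not of w, so the values of w at [lo j] and [hi j] are the exchanged
   ones. *)
have /andP[/eqP e1 /eqP e2] : (w (lo j) == lo i) && (w (hi j) == hi i).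
  apply/negPn/negP=> h; move: jd; rewrite inE !permM.
  have h' : ~~ ((w (lo j) == hi i) && (w (hi j) == lo i)).
    by apply/negP=> /andP[/eqP e1 /eqP e2]; move: jw; rewrite e1 e2 /=; lia.
  by rewrite adj_ltn // 1?andbC // ltnNge ltnW.
have ec : (w * adj i)%g = (adj j * w)%g.
  by rewrite /adj -e1 -e2 -tpermJ conjgE !mulgA mulgV mul1g.
(* Appending j on the right gives a word for s_i w of the same length, hence also reduced. *)
have Rw' : reduced_expression (rw w ++ [:: j]) (w * adj i)%g.
  apply/reducedP; split.
    by rewrite word_perm_cat ec /= mul1g; have [->] := rw_reduced w.
  by rewrite size_cat addn1 reduced_size card_inversions_adj.
rewrite (hpibar_word_reduced Rw Rw') /hpibar_word big_cat /= big_seq1.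
by rewrite -scalerA killed // scaler0; apply: spanned0.
Qed.

Lemma spanned_hpibar i u : spanned u -> spanned (hpibar F i *: u).
Proof.
move=> [c ->]; rewrite scaler_sumr; apply: big_ind => [||w _].
- exact: spanned0.
- exact: spannedD.
rewrite scalerA mulr_algr -mulr_algl -scalerA.
by apply/spannedZ/spanned_hpibar_basis; case: w.
Qed.

Lemma spanned_term (t : hterm F n) u : spanned u -> spanned (hclass t *: u).
Proof.
elim: t u => [i|a|x IHx y IHy|x IHx y IHy] u su.
- rewrite -[hclass _](subrK 1) scalerDl scale1r.
  by apply: spannedD => //; apply: spanned_hpibar.
- by rewrite hclassScal; apply: spannedZ.
- by rewrite hclassD scalerDl; apply: spannedD; [apply: IHx|apply: IHy].
- by rewrite hclassM -scalerA; apply/IHx/IHy.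
Qed.

Lemma spanned_cyclic (h : hecke0 F n) : spanned (h *: v).
Proof.
rewrite -[h]hclassK; apply: spanned_term; rewrite -[v]scale1r.
(* The chosen word of the identity is empty, so v itself is a member of the family. *)
have rw1 : rw 1%g = [::].
  by apply/nilP; rewrite /nilp reduced_size inversions1 cards0.
have <- : hpibar_word F (rw 1%g) = 1 by rewrite rw1 /hpibar_word big_nil.
apply: spanned_basis; apply/subsetP=> j; rewrite inE !perm1 /=; lia.
Qed.

End Spanning.

(** * Comparison of H_n(0) x_alpha with M_alpha through leading parts *)

Section Comparison.
Variables (F : fieldType) (n : nat) (alpha : seq nat).
Hypothesis halpha : is_composition n alpha.
Let D := comp_descents n alpha.
Let tau0 := std_filling halpha.
Implicit Types (tau sigma : filling n alpha) (u v : fillings_space n alpha F).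
Implicit Types (f g : {mpoly F[n]}).

(** An increasing row is the sorted list of its entries, and [row_of] determines which they are. *)
Lemma row_of_inj tau sigma : row_of tau =1 row_of sigma -> tau = sigma.
Proof.
move=> e; apply/val_inj/ffunP=> -[r a] /=.
pose s (rho : filling n alpha) :=
  [seq nat_of_ord (rho (mk_cell b)) | b <- enum 'I_(nth 0%N alpha r)].
have sorted_s rho : sorted ltn (s rho).
  rewrite sorted_map.
  apply: (@sub_sorted _ (relpre (@nat_of_ord _) ltn)); last first.
    by rewrite -sorted_map val_enum_ord iota_ltn_sorted.
  move=> x y xy /=; case/andP: (fillingP rho) => _ /forallP/(_ r)/forallP/(_ x).
  by move=> /forallP/(_ y)/implyP; apply.
have mem_s rho k : (k \in s rho) = [exists x : 'I_n, (val x == k) && (row_of rho x == r)].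
  apply/mapP/existsP=> [[b _ ->]|[x /andP[/eqP <- /eqP er]]].
    by exists (rho (mk_cell b)); rewrite eqxx row_ofE eqxx.
  have [[r' b] /eqP ex] := filling_ex rho x.
  have err : r' = r by apply: val_inj; move: er; rewrite -ex row_ofE.
  by subst r'; exists b; rewrite ?mem_enum // -ex.
have es : s tau = s sigma.
  apply: (irr_sorted_eq ltn_trans ltnn (sorted_s _) (sorted_s _)) => k.
  by rewrite !mem_s; apply: eq_existsb => x; rewrite e.
have la : (a < size (enum 'I_(nth 0%N alpha r)))%N by rewrite size_enum_ord.
have nth_s rho : nth 0%N (s rho) a = rho (mk_cell a).
  by rewrite (nth_map a) //; congr (nat_of_ord (rho (mk_cell _))); apply: nth_ord_enum.
by apply: val_inj; rewrite /= -!nth_s es.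
Qed.

(** The exponent of x_k counts the rows above that of k; by [row_of_le] the subtraction never
    truncates. *)
Definition row_mnm tau : 'X_{1..n} := [multinom (#|D| - row_of tau k)%N | k < n].

Lemma row_of_le tau k : (row_of tau k <= #|D|)%N.
Proof.
by have [w _ aw] := filling_acts_as halpha tau; rewrite (acts_as_row _ aw) std_row_le.
Qed.

Lemma row_mnm_inj : injective row_mnm.
Proof.
move=> tau sigma e; apply: row_of_inj => k.
have := congr1 (fun m : 'X_{1..n} => m k) e; rewrite !mnmE.
have := row_of_le tau k; have := row_of_le sigma k; lia.
Qed.

Let s := sumsq (row_mnm tau0).

(** The exponents for tau = w o tau_0 are those for tau_0 permuted by w. *)
Lemma sumsq_row_mnm tau : sumsq (row_mnm tau) = s.
Proof.
have [w _ aw] := filling_acts_as halpha tau.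
rewrite /sumsq (reindex_inj (h := w)) /=; last exact: perm_inj.
by apply: eq_bigr => k _; rewrite !mnmE (acts_as_row _ aw) permK row_of_std.
Qed.

(** x_k occurs once for each j in D with k <= j; [std_row] counts the other elements of D. *)
Lemma x_comp_row_mnm : x_comp F n alpha = 'X_[row_mnm tau0].
Proof.
rewrite mpolyXE_id /x_comp (exchange_big_dep xpredT) //=; apply: eq_bigr => k _.
rewrite prodr_const mnmE row_of_std; congr (_ ^+ _).
pose L := [set j : 'I_n.-1 | (j < k)%N].
have -> : std_row n alpha k = #|D :&: L| by apply: eq_card => j; rewrite !inE.
rewrite -(cardsID L D) addKn; apply: eq_card => j.
by rewrite [RHS]inE [j \in L]inE -leqNgt andbC.
Qed.

Definition leading_part v : {mpoly F[n]} :=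
  \sum_tau (v tau : F) *: ('X_[row_mnm tau] : {mpoly F[n]}).

Lemma leading_part_linear : linear leading_part.
Proof.
move=> a u v; rewrite /leading_part scaler_sumr -big_split /=; apply: eq_bigr => t _.
by rewrite !ffunE scalerDl scalerA.
Qed.

HB.instance Definition _ := GRing.isLinear.Build F (fillings_space n alpha F)
  {mpoly F[n]} _ leading_part leading_part_linear.

Lemma leading_part_fbase tau : leading_part (fbase F tau) = 'X_[row_mnm tau].
Proof.
rewrite /leading_part (bigD1 tau) //= big1 ?addr0 => [|t ts].
  by rewrite ffunE eqxx scale1r.
by rewrite ffunE (negPf ts) scale0r.
Qed.

(** Distinct fillings have distinct monomials, all of weight s, so every coefficient of v is one
    that must vanish. *)
Lemma low_leading_part v : low s (leading_part v) -> v = 0.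
Proof.
move=> lv; apply/ffunP=> tau; rewrite [RHS]ffunE.
have := lv (row_mnm tau); rewrite sumsq_row_mnm => /(_ (leqnn _)).
rewrite /leading_part raddf_sum /= (bigD1 tau) //= big1 => [|t ts].
  by rewrite mcoeffZ mcoeffX eqxx mulr1 addr0.
by rewrite mcoeffZ mcoeffX (inj_eq row_mnm_inj) (negPf ts) mulr0.
Qed.

(** A higher row means a smaller exponent, so the three cases of pibar_i on fillings match those on
    monomials up to lower weight. *)
Lemma low_demazure_bar_leading i v :
  low s (demazure_bar i (leading_part v) - leading_part (Mpibar i v)).
Proof.
have -> : demazure_bar i (leading_part v) =
    \sum_tau (v tau : F) *: demazure_bar i ('X_[row_mnm tau] : {mpoly F[n]}).
  by rewrite linear_sum; apply: eq_bigr => tau _; rewrite linearZ_LR /=.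
have -> : leading_part (Mpibar i v) =
    \sum_tau (v tau : F) *: leading_part (Mpibar i (fbase F tau)).
  rewrite [in LHS](fbase_decomp v) [Mpibar i _]linear_sum /= [LHS]linear_sum.
  by apply: eq_bigr => tau _; rewrite [Mpibar i _]linearZ_LR /= linearZ_LR /=.
rewrite -sumrB; apply: low_sum => tau _; rewrite -scalerBr; apply: lowZ.
rewrite -(sumsq_row_mnm tau).
have lt_mnm k l : (row_of tau k < row_of tau l)%N -> (row_mnm tau l < row_mnm tau k)%N.
  by rewrite !mnmE; have := row_of_le tau k; have := row_of_le tau l; lia.
have [h|h|h] := ltngtP (row_of tau (lo i)) (row_of tau (hi i)).
- rewrite Mpibar_lt // leading_part_fbase.
  have -> : row_mnm (swap i tau) = mperm (row_mnm tau) i.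
    by apply/mnmP=> k; rewrite !mnmE row_of_swap ?ltn_eqF.
  exact/demazure_bar_gt/lt_mnm.
- rewrite Mpibar_gt // linearN /= opprK leading_part_fbase.
  exact/demazure_bar_lt/lt_mnm.
- rewrite Mpibar_eq // linear0 demazure_bar_eq0 ?subr0; first exact: low0.
  by rewrite !mnmE h.
Qed.

Definition represents f v : Prop := low s (f - leading_part v).

Lemma represents_term (t : hterm F n) f v : represents f v ->
  represents (term_act (demazure_rep F n) t f) (term_act (M_rep n alpha F) t v).
Proof.
have RD f1 v1 f2 v2 : represents f1 v1 -> represents f2 v2 ->
    represents (f1 + f2) (v1 + v2).
  move=> R1 R2; rewrite /represents linearD opprD addrACA; exact: lowD.
elim: t f v => [i|a|x IHx y IHy|x IHx y IHy] f v R /=.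
- rewrite -[demazure i f](subrK f); apply: RD => //.
  (* The error is pibar_i of the old error, which stays low, plus the failure of [leading_part] to
     commute with pibar_i. *)
  rewrite /represents -[X in low _ X](subrKA (demazure_bar i (leading_part v))).
  apply: lowD; last exact: low_demazure_bar_leading.
  by rewrite -[demazure i f - f]/(demazure_bar i f) -linearB; apply: low_demazure_bar.
- by rewrite /represents linearZ -scalerBr; apply: lowZ.
- by apply: RD; [apply: IHx|apply: IHy].
- exact/IHx/IHy.
Qed.

Let x : poly_module F n := x_comp F n alpha.
Let y : M_module F n alpha := fbase F tau0.

(** x_alpha has leading part tau_0, so h x_alpha has leading part h tau_0, and [low_leading_part]
    applies when the former is 0. *)
Lemma annihilator_x_comp (h : hecke0 F n) : h *: x = 0 -> h *: y = 0.
Proof.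
have [t <-] : exists t, hclass t = h by eexists; apply: hclassK.
move=> tx; have R : represents x y.
  by rewrite /represents leading_part_fbase /x x_comp_row_mnm subrr; apply: low0.
have := represents_term t R.
rewrite -[term_act _ t x]hecke_act_pi -[hecke_act _ _ x]/(hclass t *: x) tx.
rewrite /represents sub0r => /lowN; rewrite opprK => /low_leading_part <-.
by rewrite -hecke_act_pi.
Qed.

(** For j outside D the two variables have equal exponents in x_alpha. *)
Lemma hpibar_x_comp j : j \notin D -> hpibar F j *: x = 0.
Proof.
move=> jD; rewrite hmod_pibarE /x x_comp_row_mnm.
apply: demazure_bar_eq0; rewrite !mnmE !row_of_std /=.
by rewrite (std_rowS alpha) (negPf jD) addn0.
Qed.

Variable rw : 'S_n -> seq 'I_n.-1.
Hypothesis rw_reduced : forall w : 'S_n, reduced_expression (rw w) w.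

(** Distinct w give distinct fillings, so the coefficient at the filling of w is [c w] alone. *)
Lemma M_free (c : cosets n alpha -> F) :
  \sum_w (c w)%:A *: (hpibar_word F (rw (val w)) *: y) = 0 -> forall w, c w = 0.
Proof.
move=> e w; have [tau aw ew] := hpibar_word_std halpha F (rw_reduced (val w)) (valP w).
move/(congr1 (fun v : fillings_space n alpha F => v tau)): e.
rewrite sum_ffunE [RHS]ffunE (bigD1 w) //= big1 ?addr0 => [|u uw].
  by rewrite ew hmod_scalarE !ffunE eqxx /GRing.scale /= mulr1.
have [sigma au eu] := hpibar_word_std halpha F (rw_reduced (val u)) (valP u).
rewrite eu hmod_scalarE !ffunE; case: eqP => [e|_]; last exact: scaler0.
by case/eqP: uw; apply: val_inj; move: au; rewrite -e => au; exact: acts_as_inj au aw.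
Qed.

Lemma M_cyclic (v : M_module F n alpha) : exists h : hecke0 F n, v = h *: y.
Proof.
have gen tau : exists h : hecke0 F n, fbase F tau = h *: y.
  have [w gw aw] := filling_acts_as halpha tau.
  have [sigma as_ e] := hpibar_word_std halpha F (rw_reduced w) gw.
  by exists (hpibar_word F (rw w)); rewrite e (acts_as_eq aw as_).
rewrite (fbase_decomp v).
pose P (u : M_module F n alpha) := exists h : hecke0 F n, u = h *: y.
apply: (big_ind P) => [||tau _].
- by exists 0; rewrite scale0r.
- by move=> _ _ [h ->] [h' ->]; exists (h + h'); rewrite scalerDl.
have [h e] := gen tau; exists ((v tau : F)%:A * h).
by rewrite -scalerA -e hmod_scalarE.
Qed.

Lemma x_comp_free (c : cosets n alpha -> F) :
  \sum_w (c w)%:A *: (hpibar_word F (rw (val w)) *: x) = 0 -> forall w, c w = 0.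
Proof.
move=> e; apply: M_free; set S := LHS.
have -> : S = (\sum_w (c w)%:A * hpibar_word F (rw (val w))) *: y.
  by rewrite scaler_suml; apply: eq_bigr => w _; rewrite scalerA.
apply: annihilator_x_comp; rewrite scaler_suml -[RHS]e.
by apply: eq_bigr => w _; rewrite scalerA.
Qed.

(** By spanning, h agrees on x_alpha with a combination h' of the pibar_w. As h - h' kills x_alpha,
    it kills tau_0, so h' kills tau_0, and freeness in M_alpha makes its coefficients vanish. *)
Lemma annihilator_fbase (h : hecke0 F n) : h *: y = 0 -> h *: x = 0.
Proof.
move=> hy; have [c ec] := spanned_cyclic hpibar_x_comp rw_reduced h.
pose h' := \sum_w (c w)%:A * hpibar_word F (rw (val w)).
have h'E (V : lmodType (hecke0 F n)) (z : V) :
    h' *: z = \sum_w (c w)%:A *: (hpibar_word F (rw (val w)) *: z).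
  by rewrite scaler_suml; apply: eq_bigr => w _; rewrite scalerA.
have /annihilator_x_comp : (h - h') *: x = 0 by rewrite scalerBl h'E -ec subrr.
rewrite scalerBl hy sub0r => /eqP; rewrite oppr_eq0 h'E => /eqP/M_free c0.
by rewrite ec big1 // => w _; rewrite c0 !scale0r.
Qed.

End Comparison.

(** * Isomorphism of cyclic modules whose generators have equal annihilators *)

Section CyclicIsomorphism.
Variables (A : pzRingType) (V W : lmodType A) (v : V) (w : W).
Hypothesis annv : forall a : A, a *: v = 0 -> a *: w = 0.
Hypothesis annw : forall a : A, a *: w = 0 -> a *: v = 0.
Hypothesis genw : forall z : W, exists a : A, z = a *: w.

Lemma cyclic_submod_ex (u : cyclic_submod v) : exists a : A, cyclic_val u = a *: v.
Proof. by case: u => u /= /asboolP. Qed.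

Lemma cyclic_val_sum (I : finType) (a b : I -> A) :
  cyclic_val (\sum_i a i *: cyclic_elt v (b i)) = \sum_i a i *: (b i *: v).
Proof. exact: (big_morph (@cyclic_val A V v)). Qed.

Let coef (u : cyclic_submod v) : A := sval (cid (cyclic_submod_ex u)).

Let coefE u : cyclic_val u = coef u *: v.
Proof. exact: svalP (cid (cyclic_submod_ex u)). Qed.

Definition cyclic_map (u : cyclic_submod v) : W := coef u *: w.

(** The choice made in [coef] is immaterial: two coefficients of u differ by an element killing v,
    hence w. *)
Lemma cyclic_mapE u a : cyclic_val u = a *: v -> cyclic_map u = a *: w.
Proof.
move=> e; apply/eqP; rewrite -subr_eq0 -scalerBl; apply/eqP/annv.
by rewrite scalerBl -coefE e subrr.
Qed.

Lemma cyclic_map_linear : linear cyclic_map.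
Proof.
move=> a u u'; rewrite (@cyclic_mapE _ (a * coef u + coef u')).
  by rewrite scalerDl -scalerA.
by rewrite cyclic_val_linear !coefE scalerDl scalerA.
Qed.

HB.instance Definition _ := GRing.isLinear.Build A (cyclic_submod v) W _
  cyclic_map cyclic_map_linear.

Lemma cyclic_iso : isomorphic_modules (cyclic_submod v) W.
Proof.
exists cyclic_map.
exists (fun z => cyclic_elt v (sval (cid (genw z)))) => [u|z].
  have := svalP (cid (genw (cyclic_map u))); set a := sval _ => ea.
  apply: val_inj; rewrite /= [RHS]coefE; apply/eqP.
  by rewrite -subr_eq0 -scalerBl; apply/eqP/annw; rewrite scalerBl -ea subrr.
by rewrite /= (cyclic_mapE (a := sval (cid (genw z)))) // -(svalP (cid (genw z))).
Qed.

End CyclicIsomorphism.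

Theorem proposition5p4 (F : fieldType) (n : nat) (alpha : seq nat)
    (halpha : is_composition n alpha) :
  (forall rw : 'S_n -> seq 'I_n.-1,
     (forall w : 'S_n, reduced_expression (rw w) w) ->
     is_basis
       (fun w : {w : 'S_n | descents w \subset comp_descents n alpha} =>
          cyclic_elt (x_comp F n alpha : poly_module F n)
            (hpibar_word F (rw (val w))))) /\
  isomorphic_modules
    (cyclic_submod (x_comp F n alpha : poly_module F n))
    (M_module F n alpha).
Proof.
split=> [rw rwP|].
  split=> [c e|u].
    by apply: (x_comp_free halpha rwP); rewrite -cyclic_val_sum e.
  have [h eh] := cyclic_submod_ex u.
  have [c ec] := spanned_cyclic (hpibar_x_comp F halpha) rwP h.
  by exists c; apply: val_inj; rewrite [LHS]eh ec -cyclic_val_sum.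
(* For the isomorphism any choice of reduced words serves. *)
have [rw rwP] : exists rw : 'S_n -> seq 'I_n.-1,
    forall w : 'S_n, reduced_expression (rw w) w.
  exists (fun w => sval (cid (reduced_expression_ex w))) => w.
  exact: svalP (cid (reduced_expression_ex w)).
apply: (cyclic_iso (w := fbase F (std_filling halpha) : M_module F n alpha)).
- exact: annihilator_x_comp.
- exact: annihilator_fbase rwP.
- exact: M_cyclic rwP.
Qed.
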